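(* Let $k=-5/3$, and define $$\mathcal S_k=\left\{(-\tfrac19,0),(0,0),(\tfrac13,\tfrac13),(-\tfrac13,\tfrac23),(-\tfrac49,\tfrac13),(-\tfrac79,\tfrac23)\right\},\qquad \widetilde{\mathcal S_k}=\left\{(\tfrac19,-\tfrac19),(\tfrac49,-\tfrac19),(\tfrac79,-\tfrac19)\right\}.$$ Assume that $L(x,y)$ is an irreducible $\mathcal W_k$-module. Then: (i) $(x,y)\in\mathcal S_k\cup\widetilde{\mathcal S_k}$. (ii) If $L(x,y)_{top}$ is finite-dimensional, then $(x,y)\in\mathcal S_k$.
   Context: For $k\in\mathbb C$, $k\ne -3$, $\mathcal W^k=\mathcal W^k(sl_3,f_\theta)$ is the universal Bershadsky-Polyakov vertex algebra of level $k$: the universal vertex algebra strongly generated by even fields $J,T,G^+,G^-$ with OPEs $J(z)J(w)\sim \frac{2k+3}{3}(z-w)^{-2}$, $G^\pm(z)G^\pm(w)\sim 0$, $J(z)G^\pm(w)\sim \pm G^\pm(w)(z-w)^{-1}$, $T(z)T(w)\sim \frac{c_k}{2}(z-w)^{-4}+2T(w)(z-w)^{-2}+DT(w)(z-w)^{-1}$, $T(z)G^\pm(w)\sim\frac32 G^\pm(w)(z-w)^{-2}+DG^\pm(w)(z-w)^{-1}$, $T(z)J(w)\sim J(w)(z-w)^{-2}+DJ(w)(z-w)^{-1}$, $G^+(z)G^-(w)\sim (k+1)(2k+3)(z-w)^{-3}+3(k+1)J(w)(z-w)^{-2}+\left(3:J(w)J(w):+\frac{3(k+1)}{2}DJ(w)-(k+3)T(w)\right)(z-w)^{-1}$,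 where $c_k=-\frac{(3k+1)(2k+3)}{k+3}$ and $D$ is the translation operator (derivative). $\mathcal W_k$ is its unique simple quotient. Modes: $T(z)=\sum L_nz^{-n-2}$, $J(z)=\sum J_nz^{-n-1}$, $G^\pm(z)=\sum G^\pm_nz^{-n-1}$. Set $J(n)=J_n$, $L(n)=L_n-\frac{n+1}{2}J_n$, $G^+(n)=G^+_n$, $G^-(n)=G^-_{n+1}$; the $L(n)$ are the modes of the conformal vector $\overline\omega=\omega+\frac12 DJ$, where $\omega$ is the conformal vector of $T$. For $(x,y)\in\mathbb C^2$, $L(x,y)$ is the irreducible $\mathcal W^k$-module generated by a highest weight vector $v(x,y)$ with $J(0)v(x,y)=xv(x,y)$, $L(0)v(x,y)=yv(x,y)$, and $J(n)v(x,y)=L(n)v(x,y)=G^+(n)v(x,y)=G^-(n-1)v(x,y)=0$ for $n\ge1$. $L(x,y)$ is a $\mathcal W_k$-module if the action of $\mathcal W^k$ factors through $\mathcal W_k$. $L(x,y)_{top}=\{v\in L(x,y): L(0)v=yv\}$. *)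

(* Defs.v *)
From HB Require Import structures.
From mathcomp Require Import all_boot all_order all_algebra.
From mathcomp Require Import complex classical_sets reals.

Set Implicit Arguments.
Unset Strict Implicit.
Unset Printing Implicit Defensive.

Import Order.TTheory GRing.Theory Num.Theory.

Local Open Scope classical_set_scope.
Local Open Scope ring_scope.

Section LinearAlgebra.
Variables (K : numFieldType) (V : lmodType K).
Implicit Types P A : set V.

Definition subspace P :=
  P 0 /\ forall (c : K) (u v : V), P u -> P v -> P (c *: u + v).

Definition span A : set V :=
  [set v | exists (n : nat) (c : 'I_n -> K) (e : 'I_n -> V),
     (forall i, A (e i)) /\ v = \sum_(i < n) c i *: e i].

Definition finite_dim P :=
  exists (n : nat) (e : 'I_n -> V), P = span (range e).

End LinearAlgebra.

(* The binomial coefficient m(m-1)...(m-i+1)/i! for an arbitrary integer m. *)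
Definition binz (K : numFieldType) (m : int) (i : nat) : K :=
  (\prod_(j < i) (m - j%:Z)%:~R) / (i`!)%:R.

(* The Borcherds (component Jacobi) identity for the modes of a and b acting   *)
(* on c, where nprod a n b is the n-th product a_(n) b and act a n is the n-th *)
(* mode of a:                                                                  *)
(*   sum_i C(m,i) (a_(l+i) b)_(m+n-i) c                                        *)
(*     = sum_i (-1)^i C(l,i) (a_(l+m-i) b_(n+i) c - (-1)^l b_(l+n-i) a_(m+i) c)*)
(* Both sums over i >= 0 are finite by truncation, so they are cut at any N    *)
(* beyond which all of their terms vanish.                                     *)
Definition borcherds_identity (K : numFieldType) (V M : lmodType K)
    (nprod : V -> int -> V -> V) (act : V -> int -> M -> M) :=
  forall (a b : V) (c : M) (l m n : int) (N : nat),
    (forall i : nat, (N <= i)%N ->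
       [/\ nprod a (l + i%:Z) b = 0,
           act b (n + i%:Z) c = 0 &
           act a (m + i%:Z) c = 0]) ->
    \sum_(i < N) binz K m i *: act (nprod a (l + i%:Z) b) (m + n - i%:Z) c =
    \sum_(i < N) ((-1) ^+ i * binz K l i) *:
      (act a (l + m - i%:Z) (act b (n + i%:Z) c)
       - (-1 : K) ^ l *: act b (l + n - i%:Z) (act a (m + i%:Z) c)).

Definition truncation (K : numFieldType) (V M : lmodType K)
    (act : V -> int -> M -> M) :=
  forall (a : V) (c : M), exists N : int, forall n, N <= n -> act a n c = 0.

HB.mixin Record isVertexAlgebra (K : numFieldType) V of GRing.Lmodule K V := {
  vac : V;
  nprod : V -> int -> V -> V;
  nprod_linearl : forall n b, linear (fun a : V => nprod a n b);
  nprod_linearr : forall a n, linear (nprod a n);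
  nprod_trunc : truncation nprod;
  nprod_vacl : forall n b, nprod vac n b = if n == -1 then b else 0;
  nprod_vacr : forall a, nprod a (-1) vac = a;
  nprod_vacr0 : forall a (n : nat), nprod a n%:Z vac = 0;
  nprod_borcherds : borcherds_identity nprod nprod
}.

#[short(type="vertexAlgType")]
HB.structure Definition VertexAlgebra (K : numFieldType) :=
  { V of isVertexAlgebra K V & GRing.Lmodule K V }.

Arguments vac {K s}.

Section VertexAlgebraTheory.
Variables (K : numFieldType).

Definition vaD (V : vertexAlgType K) (a : V) : V := nprod a (-2) vac.

(* OPE a b [:: c_0; c_1; ...] says a(z)b(w) ~ sum_j c_j(w) (z-w)^(-j-1): in   *)
(* a vertex algebra the coefficient of (z-w)^(-j-1) is the field of a_(j) b.  *)
Definition OPE (V : vertexAlgType K) (a b : V) (s : seq V) :=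
  forall j : nat, nprod a j%:Z b = s`_j.

Definition is_va_hom (U V : vertexAlgType K) (f : U -> V) :=
  [/\ linear f,
      f vac = vac &
      forall a n b, f (nprod a n b) = nprod (f a) n (f b)].

Definition va_ideal (V : vertexAlgType K) (I : set V) :=
  subspace I /\
  forall a n b, I b -> I (nprod a n b) /\ I (nprod b n a).

Definition simple_va (V : vertexAlgType K) :=
  (vac : V) <> 0 /\
  forall I : set V, va_ideal I -> I = [set 0] \/ I = setT.

Definition is_simple_quotient (U V : vertexAlgType K) (f : U -> V) :=
  [/\ is_va_hom f, range f = setT & simple_va V].

(* The monomials a^1_(-n_1-1) ... a^r_(-n_r-1) vac, with n_1, ..., n_r >= 0.  *)
Definition va_monomial (V : vertexAlgType K) (s : seq (V * nat)) : V :=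
  foldr (fun p b => nprod p.1 (- (p.2%:Z) - 1) b) vac s.

Definition strongly_generated (V : vertexAlgType K) (gens : seq V) :=
  span [set va_monomial s | s in
          [set s : seq (V * nat) | all (fun p => p.1 \in gens) s]] = setT.

Record vaModule (V : vertexAlgType K) (M : lmodType K) := VaModule {
  mode :> V -> int -> M -> M;
  mode_linearl : forall n m, linear (fun a : V => mode a n m);
  mode_linearr : forall a n, linear (mode a n);
  mode_trunc : truncation mode;
  mode_vac : forall n m, mode vac n m = if n == -1 then m else 0;
  mode_borcherds : borcherds_identity (@nprod K V) mode
}.

Definition submodule (V : vertexAlgType K) (M : lmodType K)
    (act : vaModule V M) (P : set M) :=
  subspace P /\ forall a n m, P m -> P (act a n m).

Definition irreducible_module (V : vertexAlgType K) (M : lmodType K)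
    (act : vaModule V M) :=
  (exists m : M, m <> 0) /\
  forall P : set M, submodule act P -> P = [set 0] \/ P = setT.

Definition factors_through (U V : vertexAlgType K) (f : U -> V)
    (M : lmodType K) (act : vaModule U M) :=
  exists act' : vaModule V M, forall a n m, act a n m = act' (f a) n m.

Definition central_charge (k : K) : K :=
  - ((3 * k + 1) * (2 * k + 3)) / (k + 3).

Record BP_OPEs (k : K) (V : vertexAlgType K) (J T Gp Gm : V) : Prop := {
  ope_JJ : OPE J J [:: 0; ((2 * k + 3) / 3) *: vac];
  ope_GpGp : OPE Gp Gp [::];
  ope_GmGm : OPE Gm Gm [::];
  ope_JGp : OPE J Gp [:: Gp];
  ope_JGm : OPE J Gm [:: - Gm];
  ope_TT : OPE T T
    [:: vaD T; 2 *: T; 0; (central_charge k / 2) *: vac];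
  ope_TGp : OPE T Gp [:: vaD Gp; (3 / 2) *: Gp];
  ope_TGm : OPE T Gm [:: vaD Gm; (3 / 2) *: Gm];
  ope_TJ : OPE T J [:: vaD J; J];
  ope_GpGm : OPE Gp Gm
    [:: 3 *: nprod J (-1) J + (3 * (k + 1) / 2) *: vaD J - (k + 3) *: T;
        (3 * (k + 1)) *: J;
        ((k + 1) * (2 * k + 3)) *: vac]
}.

(* W, with the fields J, T, Gp, Gm, is W^k: it is strongly generated by them  *)
(* and initial among vertex algebras with four fields having these OPEs.      *)
Record universal_BP (k : K) (W : vertexAlgType K) (J T Gp Gm : W) : Prop := {
  BP_opes : BP_OPEs k J T Gp Gm;
  BP_gen : strongly_generated [:: J; T; Gp; Gm];
  BP_universal : forall (V : vertexAlgType K) (J' T' Gp' Gm' : V),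
    BP_OPEs k J' T' Gp' Gm' ->
    exists! f : W -> V,
      is_va_hom f /\ [/\ f J = J', f T = T', f Gp = Gp' & f Gm = Gm']
}.

Section Modes.
Variables (W : vertexAlgType K) (M : lmodType K) (act : vaModule W M).

(* The shifted modes J(n), L(n), G^+(n), G^-(n).  The modes of the fields are *)
(* J_n = J_(n), G^{+,-}_n = G^{+,-}_(n) and L_n = T_(n+1).                    *)
Definition modeJ (J : W) (n : int) (m : M) : M := act J n m.
Definition modeL (J T : W) (n : int) (m : M) : M :=
  act T (n + 1) m - ((n + 1)%:~R / 2) *: act J n m.
Definition modeGp (Gp : W) (n : int) (m : M) : M := act Gp n m.
Definition modeGm (Gm : W) (n : int) (m : M) : M := act Gm (n + 1) m.

(* (M, v) is the irreducible highest weight module L(x,y) with its highest    *)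
(* weight vector v(x,y); such a pair is unique up to isomorphism.             *)
Record is_Lxy (J T Gp Gm : W) (x y : K) (v : M) : Prop := {
  Lxy_irr : irreducible_module act;
  Lxy_neq0 : v <> 0;
  Lxy_gen : forall P : set M, submodule act P -> P v -> P = setT;
  Lxy_J0 : modeJ J 0 v = x *: v;
  Lxy_L0 : modeL J T 0 v = y *: v;
  Lxy_ann : forall n : int, 1 <= n ->
    [/\ modeJ J n v = 0, modeL J T n v = 0,
        modeGp Gp n v = 0 & modeGm Gm (n - 1) v = 0]
}.

Definition Lxy_top (J T : W) (y : K) : set M :=
  [set m | modeL J T 0 m = y *: m].

End Modes.

Definition Sk : set (K * K) :=
  [set (- (1 / 9), 0)] `|` [set (0, 0)] `|` [set (1 / 3, 1 / 3)] `|`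
  [set (- (1 / 3), 2 / 3)] `|` [set (- (4 / 9), 1 / 3)] `|`
  [set (- (7 / 9), 2 / 3)].

Definition Sk_tilde : set (K * K) :=
  [set (1 / 9, - (1 / 9))] `|` [set (4 / 9, - (1 / 9))] `|`
  [set (7 / 9, - (1 / 9))].

End VertexAlgebraTheory.

Arguments Sk {K}.
Arguments Sk_tilde {K}.

(* Main.v *)
Require Import Defs.
From Corelib Require Import BinNums.
From mathcomp Require Import all_boot all_order all_algebra.
From mathcomp Require Import complex boolp classical_sets reals.
From mathcomp Require Import ssrZ zify ring lra.
Import Order.TTheory GRing.Theory Num.Theory.
Set Implicit Arguments.
Unset Strict Implicit.
Unset Printing Implicit Defensive.
Local Open Scope classical_set_scope.
Local Open Scope ring_scope.

(* At k = -5/3 the algebra W^k contains a singular vector Omega of conformal   *)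
(* weight 4 and J(0)-charge 0.  The ideal of W_k generated by its image lives  *)
(* in weights >= 4, so it misses the vacuum and vanishes by simplicity; hence  *)
(* Omega acts by 0 on L(x,y).  Zhu's relations express the zero mode of Omega  *)
(* on the top component through those of J, T, G^+, G^-, so that on            *)
(* u_n = G^+(0)^n v it is a scalar P_n(x,y), polynomial in x, y and in the     *)
(* coefficient h_n of G^-(0) u_n = h_n u_(n-1).  P_n is quadratic in n, with   *)
(* P_2 - 2 P_1 + P_0 proportional to 9 y + 1, and the weights are found by     *)
(* distinguishing u_1 = 0, u_2 = 0 and u_2 <> 0.  At the weights with          *)
(* y = -1/9 every h_n with n > 0 is negative, so all the u_n are nonzero and   *)
(* the top component is infinite-dimensional.                                  *)

(** * Linear algebra *)

(** The proof turns a statement about infinite-dimensional modules into polynomial equations in x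
    and y, with two finite computations at its core. That every weight-lowering generator mode kills
    [Omega] ([Omega_low]), and what the zero mode of [Omega] is on a top vector ([Omega_zero_mode]),
    are both obtained by evaluating verified rewriting procedures, [lmode] and [zstep], on formal
    words with integer coefficients. Between these computations stands the grading by the shifted
    L(0). Vectors of W of negative weight vanish ([eig_neg]), and a vector killed by the
    weight-lowering generator modes is killed by all weight-lowering modes ([lowest_kill]), so it
    generates only weights above its own ([span_modes_graded]). For the image of [Omega] this yields
    [pi_Omega]; for v(x,y) it yields [top_kill], the hypothesis under which Zhu's relations apply.
    The resulting scalar equations [Omega_poly_eq0] are solved in [highest_weights], and
    [top_infinite] settles the remaining weights. *)

Section LinearFacts.
Variables (K : numFieldType) (U V : lmodType K).

Section LinearFun.
Variables (f : U -> V) (lf : linear f).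

Lemma lin0 : f 0 = 0.
Proof. by have := lf (-1) 0 0; rewrite scaleN1r addNr scaleN1r addNr. Qed.

Lemma linD u w : f (u + w) = f u + f w.
Proof. by have := lf 1 u w; rewrite !scale1r. Qed.

Lemma linZ c u : f (c *: u) = c *: f u.
Proof. by have := lf c u 0; rewrite lin0 !addr0. Qed.

Lemma lin_sum (I : Type) (r : seq I) (P : pred I) (F : I -> U) :
  f (\sum_(i <- r | P i) F i) = \sum_(i <- r | P i) f (F i).
Proof. exact: (big_morph f linD lin0). Qed.

Lemma linN u : f (- u) = - f u.
Proof. by rewrite -scaleN1r linZ scaleN1r. Qed.

Lemma linB u w : f (u - w) = f u - f w.
Proof. by rewrite linD linN. Qed.

End LinearFun.

Section Subspace.
Variables (P : set U) (sP : subspace P).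

Lemma subspace0 : P 0. Proof. by case: sP. Qed.

Lemma subspaceD u w : P u -> P w -> P (u + w).
Proof. by move=> Pu Pw; rewrite -[u]scale1r; apply: sP.2. Qed.

Lemma subspaceZ c u : P u -> P (c *: u).
Proof. by move=> Pu; rewrite -[c *: u]addr0; apply: sP.2 => //; apply: subspace0. Qed.

Lemma subspaceB u w : P u -> P w -> P (u - w).
Proof. by move=> Pu Pw; apply: subspaceD => //; rewrite -scaleN1r; apply: subspaceZ. Qed.

Lemma subspace_sum (I : Type) (r : seq I) (Q : pred I) (F : I -> U) :
  (forall i, Q i -> P (F i)) -> P (\sum_(i <- r | Q i) F i).
Proof. by move=> PF; apply: (big_ind P) => //; [apply: subspace0 | apply: subspaceD]. Qed.

Lemma span_sub (A : set U) : A `<=` P -> Defs.span A `<=` P.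
Proof.
move=> AP u [n [c [e [Ae ->]]]]; apply: subspace_sum => i _.
by apply/subspaceZ/AP/Ae.
Qed.

End Subspace.

Lemma span_subspace (A : set U) : subspace (Defs.span A).
Proof.
split; first by exists 0%N, (fun=> 0), (fun=> 0); split; [case | rewrite big_ord0].
move=> k u w [n [c [e [Ae ->]]]] [n' [c' [e' [Ae' ->]]]].
exists (n + n')%N, (fun i => match split i with inl j => k * c j | inr j => c' j end),
  (fun i => match split i with inl j => e j | inr j => e' j end); split.
  by move=> i; case: split.
rewrite big_split_ord scaler_sumr; congr (_ + _); apply: eq_bigr => i _.
  by rewrite (unsplitK (inl i)) scalerA.
by rewrite (unsplitK (inr i)).
Qed.

Lemma span_incl (A : set U) u : A u -> Defs.span A u.
Proof.
move=> Au; exists 1%N, (fun=> 1), (fun=> u); split=> //.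
by rewrite big_ord1 scale1r.
Qed.

Lemma sum_ord_trunc (F : nat -> U) (k N : nat) : (k <= N)%N ->
  (forall i, (k <= i)%N -> F i = 0) -> \sum_(i < N) F i = \sum_(i < k) F i.
Proof.
move=> kN F0; rewrite -!(big_mkord xpredT) (big_cat_nat _ kN) //=.
by rewrite [X in _ + X]big_nat_cond [X in _ + X]big1 ?addr0 // => i /andP[/andP[/F0]].
Qed.

End LinearFacts.

Section Eigen.
Variables (K : numFieldType) (U : lmodType K) (f : U -> U) (lf : linear f).

Definition eig (mu : K) : set U := [set u | f u = mu *: u].

Lemma eig_subspace mu : subspace (eig mu).
Proof.
split=> [|c u w]; first by rewrite /eig /= (lin0 lf) scaler0.
by rewrite /eig /= lf => -> ->; rewrite scalerDr !scalerA mulrC.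
Qed.

(* prod_i (f - lam i) annihilates the e i and acts on u by prod_i (mu - lam i). *)
Lemma eig_sum_eq0 (n : nat) (lam : 'I_n -> K) (e : 'I_n -> U) mu u :
  (forall i, eig (lam i) (e i) /\ lam i != mu) ->
  eig mu u -> u = \sum_(i < n) e i -> u = 0.
Proof.
elim: n => [|n IHn] in lam e u *; first by rewrite big_ord0.
move=> He Hu def_u; rewrite big_ord_recl in def_u.
have [H0 n0] := He ord0.
suff: (mu - lam ord0) *: u = 0.
  by move/eqP; rewrite scaler_eq0 subr_eq0 eq_sym (negPf n0) => /eqP.
have E: f u - lam ord0 *: u = (mu - lam ord0) *: u by rewrite Hu scalerBl.
apply: (IHn (fun i => lam (lift ord0 i))
  (fun i => (lam (lift ord0 i) - lam ord0) *: e (lift ord0 i))).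
- by move=> i; have [Hi ni] := He (lift ord0 i); split=> //; apply: (subspaceZ (eig_subspace _)).
- exact: (subspaceZ (eig_subspace _)).
rewrite -E {1 2}def_u (linD lf) (lin_sum lf) H0 scalerDr opprD addrACA subrr add0r.
rewrite scaler_sumr -sumrB; apply: eq_bigr => i _.
by have [-> _] := He (lift ord0 i); rewrite scalerBl.
Qed.

End Eigen.

(** * Generalized binomial coefficients *)

Section Binz.
Variable K : numFieldType.

Lemma binz0 m : binz K m 0 = 1.
Proof. by rewrite /binz big_ord0 fact0 divr1. Qed.

Lemma binzS m i : binz K m i.+1 = binz K m i * (m - i%:Z)%:~R / i.+1%:R.
Proof.
rewrite /binz big_ord_recr /= factS natrM invfM.
by rewrite -!mulrA; congr (_ * _); rewrite [RHS]mulrCA; congr (_ * _); rewrite mulrC.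
Qed.

Lemma binz1 m : binz K m 1 = m%:~R.
Proof. by rewrite binzS binz0 mul1r subr0 divr1. Qed.

Lemma binz_gt (m i : nat) : (m < i)%N -> binz K m i = 0.
Proof.
elim: i => // i IHi; rewrite ltnS leq_eqVlt binzS => /orP[/eqP->|/IHi->].
  by rewrite subrr mulr0 mul0r.
by rewrite !mul0r.
Qed.

Lemma binzN1 i : (-1) ^+ i * binz K (-1) i = 1.
Proof.
elim: i => [|i IHi]; first by rewrite binz0 mulr1.
have ni : i.+1%:R != 0 :> K by rewrite pnatr_eq0.
have Ei : (-1 - i%:Z)%:~R = - i.+1%:R :> K.
  by rewrite (_ : -1 - _ = - (i.+1)%:Z) ?rmorphN //; lia.
transitivity ((-1) ^+ i * binz K (-1) i); last exact: IHi.
by rewrite binzS exprS Ei mulN1r mulrN !mulNr mulrN opprK mulfK.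
Qed.

Lemma binzN2 i : (-1) ^+ i * binz K (-2) i = i.+1%:R.
Proof.
elim: i => [|i IHi]; first by rewrite binz0 mulr1.
have ni : i.+1%:R != 0 :> K by rewrite pnatr_eq0.
have Ei : (-2 - i%:Z)%:~R = - i.+2%:R :> K.
  by rewrite (_ : -2 - _ = - (i.+2)%:Z) ?rmorphN //; lia.
transitivity ((-1) ^+ i * binz K (-2) i * (i.+2%:R / i.+1%:R)); last first.
  by rewrite IHi mulrCA divff // mulr1.
by rewrite binzS exprS Ei mulN1r mulrN !mulNr mulrN opprK !mulrA.
Qed.

End Binz.

(** * Modes on modules over a vertex algebra *)

Section Module.
Variables (K : numFieldType) (W : vertexAlgType K) (M : lmodType K).
Variable act : vaModule W M.

Lemma act0l n m : act 0 n m = 0. Proof. exact: (lin0 (mode_linearl act n m)). Qed.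
Lemma act0r a n : act a n 0 = 0. Proof. exact: (lin0 (mode_linearr act a n)). Qed.
Lemma actZl c a n m : act (c *: a) n m = c *: act a n m.
Proof. exact: (linZ (mode_linearl act n m)). Qed.
Lemma actZr c a n m : act a n (c *: m) = c *: act a n m.
Proof. exact: (linZ (mode_linearr act a n)). Qed.
Lemma actDl a b n m : act (a + b) n m = act a n m + act b n m.
Proof. exact: (linD (mode_linearl act n m)). Qed.
Lemma actNl a n m : act (- a) n m = - act a n m.
Proof. exact: (linN (mode_linearl act n m)). Qed.

(** Truncation supplies a cutoff, so later proofs may enlarge N freely and then discard the
    vanishing terms. *)
Lemma borcherds_large a b c l m n : exists N0, forall N, (N0 <= N)%N ->
    \sum_(i < N) binz K m i *: act (nprod a (l + i%:Z) b) (m + n - i%:Z) c =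
    \sum_(i < N) ((-1) ^+ i * binz K l i) *:
      (act a (l + m - i%:Z) (act b (n + i%:Z) c)
       - (-1 : K) ^ l *: act b (l + n - i%:Z) (act a (m + i%:Z) c)).
Proof.
have [N1 H1] := nprod_trunc a b; have [N2 H2] := mode_trunc act b c.
have [N3 H3] := mode_trunc act a c.
exists (`|N1 - l| + `|N2 - n| + `|N3 - m|)%N => N leN.
by apply: mode_borcherds => i leNi; split; [apply: H1 | apply: H2 | apply: H3]; lia.
Qed.

(** The case l = 0 of Borcherds: C(0,i) vanishes for i > 0, so the right-hand side is a single
    commutator. *)
Lemma commutator (k : nat) a b c m n :
  (forall i, (k <= i)%N -> nprod a i%:Z b = 0) ->
  act a m (act b n c) = act b n (act a m c) +
    \sum_(i < k) binz K m i *: act (nprod a i%:Z b) (m + n - i%:Z) c.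
Proof.
move=> Hk; have [N0 /(_ (N0 + k).+1)] := borcherds_large a b c 0 m n.
rewrite (sum_ord_trunc (F := fun i => binz K m i *: act (nprod a (0 + i%:Z) b) (m + n - i%:Z) c)
  (k := k)); [|lia|]; last by move=> i /Hk E; rewrite add0r E act0l scaler0.
rewrite big_ord_recl [X in _ = _ + X]big1 => [|i _]; last first.
  by rewrite (@binz_gt _ 0) // mulr0 scale0r.
rewrite binz0 expr0z !scale1r mulr1 scale1r !addr0 !add0r => /(_ _) E.
by rewrite -[LHS](subrK (act b n (act a m c))) addrC -E //; lia.
Qed.

(** Borcherds with b the vacuum and l = -2: the left side is (Da)_(n) + m a_(n-1), and only one
    vacuum mode survives on the right, with coefficient m - n. *)
Lemma act_vaD a n c : act (vaD a) n c = - n%:~R *: act a (n - 1) c.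
Proof.
have [B HB] := mode_trunc act a c.
(* [m] is large enough that a_(m+i) c = 0 for all i, and [j] is the index where the vacuum mode n -
   m + j equals -1. *)
pose m : int := `|B|%:Z + `|n|%:Z + 1; pose j := `|(m - n - 1)%R|%N.
have Hj : n - m = - j%:Z - 1 by rewrite /j /m; lia.
have [N0 /(_ (N0 + j).+2)] := borcherds_large a vac c (-2) m (n - m).
rewrite 2!big_ord_recl big1 ?addr0 => [|i _]; last first.
  have -> : -2 + (lift ord0 (lift ord0 i))%:Z = i%:Z by rewrite /= /bump /=; lia.
  by rewrite nprod_vacr0 act0l scaler0.
rewrite (bigD1 (inord j)) //= inordK; last by lia.
rewrite [X in _ = _ + X]big1 ?addr0 => [|i Hi]; last first.
  rewrite mode_vac ifF.
    by rewrite act0r (HB (m + _)) ?act0r ?scaler0 ?subr0 ?scaler0 //; rewrite /m; lia.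
  apply/eqP => Ei; case/eqP: Hi; apply: val_inj; rewrite /= inordK; lia.
rewrite mode_vac ifT; last by apply/eqP; lia.
rewrite (HB (m + j%:Z)) ?act0r ?scaler0 ?subr0; last by rewrite /m; lia.
rewrite /= binz0 binz1 scale1r (_ : -2 + (bump 0 0)%:Z = -1) // nprod_vacr.
rewrite binzN2.
rewrite (_ : m + (n - m) = n); last by lia.
rewrite (_ : n - (bump 0 0)%:Z = n - 1) // (_ : -2 + m - j%:Z = n - 1); last by lia.
move/(_ ltac:(lia)) => E.
rewrite /vaD -[LHS](addrK (m%:~R *: act a (n - 1) c)) E -scalerBl; congr (_ *: _).
by rewrite -[j.+1%:R]/((j.+1)%:Z%:~R) -rmorphB -rmorphN /=; congr (_%:~R); lia.
Qed.

(** The case l = -1, m = 0 of Borcherds; all coefficients (-1)^i C(-1,i) equal 1. *)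
Lemma act_normal_product (N : nat) a b n c :
  (forall i, (N <= i)%N -> [/\ nprod a (-1 + i%:Z) b = 0,
     act b (n + i%:Z) c = 0 & act a i%:Z c = 0]) ->
  act (nprod a (-1) b) n c =
    \sum_(i < N) (act a (-1 - i%:Z) (act b (n + i%:Z) c)
                  + act b (n - 1 - i%:Z) (act a i%:Z c)).
Proof.
move=> HN; have HN0 i : (N <= i)%N -> [/\ nprod a (-1 + i%:Z) b = 0,
     act b (n + i%:Z) c = 0 & act a (0 + i%:Z) c = 0].
  by rewrite add0r; apply: HN.
case: N HN HN0 => [|N] HN HN0.
  by have [] := HN 0%N isT; rewrite addr0 big_ord0 => ->; rewrite act0l.
have := @mode_borcherds _ _ _ act _ _ _ _ _ _ _ HN0.
rewrite big_ord_recl big1 => [|i _]; last by rewrite (@binz_gt _ 0) // scale0r.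
rewrite binz0 scale1r add0r !addr0 => ->.
apply: eq_bigr => i _; rewrite binzN1 scale1r add0r.
by rewrite exprN1 invrN1 scaleN1r opprK [-1 + n]addrC.
Qed.


End Module.

Section ModuleMore.
Variables (K : numFieldType) (W : vertexAlgType K) (M : lmodType K).
Variable act : vaModule W M.

(** For m >= 0 the binomials C(m,i) cut the sum at m by themselves, so no bound on the OPE of a and
    b has to be known. *)
Lemma commutator_nat (m : nat) a b c n :
  act a m%:Z (act b n c) = act b n (act a m%:Z c) +
    \sum_(i < m.+1) binz K m i *: act (nprod a i%:Z b) (m%:Z + n - i%:Z) c.
Proof.
have [B HB] := nprod_trunc a b.
rewrite (@commutator _ _ _ _ (`|B| + m).+1) => [|i Hi]; last by apply: HB; lia.
congr (_ + _); rewrite (@sum_ord_trunc _ _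
  (fun i => binz K m%:Z i *: act (nprod a i%:Z b) (m%:Z + n - i%:Z) c) m.+1) //.
  by lia.
by move=> i Hi; rewrite binz_gt // scale0r.
Qed.

Lemma commutator0 a b c n :
  act a 0 (act b n c) = act b n (act a 0 c) + act (nprod a 0 b) n c.
Proof.
by rewrite (commutator_nat 0) big_ord1 binz0 scale1r add0r subr0.
Qed.

Lemma commutator1 a b c n :
  act a 1 (act b n c) = act b n (act a 1 c) + act (nprod a 0 b) (n + 1) c
    + act (nprod a 1 b) n c.
Proof.
rewrite (commutator_nat 1) big_ord_recl big_ord1 /= binz0 (@binz1 K 1) !scale1r subr0 addrA.
by rewrite [1 + n]addrC (_ : n + 1 - _ = n) ?addrK.
Qed.

(* Zhu's relations: on a vector u killed by the modes a_(j), j >= p, and       *)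
(* b_(j), j >= q, taking m = p in the Borcherds identity kills one half of its *)
(* right-hand side.                                                            *)
Lemma zhu_identity (p q : int) (d : nat) a b u :
  0 <= p ->
  (forall j, p <= j -> act a j u = 0) -> (forall j, q <= j -> act b j u = 0) ->
  \sum_(i < `|p|.+1) binz K p i *: act (nprod a (- d.+1%:Z + i%:Z) b) (p + (q + d%:Z - 1) - i%:Z) u =
  if d is 0 then act a (p - 1) (act b (q - 1) u) else 0.
Proof.
move=> p0 Ha Hb.
have [N0 /(_ (N0 + `|p|).+1)] := borcherds_large act a b u (- d.+1%:Z) p (q + d%:Z - 1).
rewrite (sum_ord_trunc (F := fun i =>
    binz K p i *: act (nprod a (- d.+1%:Z + i%:Z) b) (p + (q + d%:Z - 1) - i%:Z) u)
  (k := `|p|.+1)); [|lia|]; last first.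
  by move=> i Hi; rewrite -(gez0_abs p0) binz_gt ?scale0r.
move=> -> //; last by lia.
rewrite big_ord_recl big1 ?addr0 => [|i _]; last first.
  rewrite Hb ?act0r; last by rewrite /= /bump /=; lia.
  by rewrite Ha ?act0r ?scaler0 ?subr0 ?scaler0 //; lia.
rewrite (Ha p) // act0r scaler0 subr0.
case: d => [|d].
  by rewrite expr0 binz0 mul1r scale1r [-1 + p]addrC addr0.
by rewrite Hb ?act0r ?scaler0 //=; lia.
Qed.

(* Borcherds with m large rewrites a_(p) b_(n) v through single modes c_(q) v. *)
Lemma submodule_span_modes v :
  submodule act (Defs.span [set m | exists b n, m = act b n v]).
Proof.
set S := Defs.span _; have sS : subspace S by apply: span_subspace.
split=> // a p m [k [c [e [He ->]]]].
rewrite (lin_sum (mode_linearr act a p)); apply: (subspace_sum sS) => i _.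
rewrite actZr; apply: (subspaceZ sS); have [b [n ->]] := He i.
have [B HB] := mode_trunc act b v; have [A HA] := mode_trunc act a v.
have [j Hj] : exists j : nat, B - n <= j%:Z by exists `|(B - n)%R|%N; lia.
elim: j n p Hj => [|j IHj] n p Hj.
  by have [/HB->|?] := lerP B n; [rewrite act0r; apply: subspace0 | lia].
have [/HB->|lt_nB] := lerP B n; first by rewrite act0r; apply: subspace0.
have [N0 /(_ N0.+1)] := borcherds_large act a b v (p - A) A n.
move=> /(_ (leqnSn _)); rewrite [X in _ = X]big_ord_recl.
rewrite /= (HA (A + _)); last by lia.
rewrite act0r scaler0 subr0 binz0 expr0 mul1r scale1r !addr0 subrK => /esym/(canRL (addrK _)) ->.
apply: (subspaceB sS); apply: (subspace_sum sS) => l _; apply: (subspaceZ sS).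
  by apply: span_incl; eexists; eexists.
rewrite /= (HA (A + _)); last by lia.
rewrite act0r scaler0 subr0.
by apply: IHj; rewrite /bump /=; lia.
Qed.

End ModuleMore.

(** * The adjoint module, pullback of modules, and skew-symmetry *)

Section RegularModule.
Variables (K : numFieldType).

Definition regmod (V : vertexAlgType K) : vaModule V V :=
  VaModule (@nprod_linearl K V) (@nprod_linearr K V) (@nprod_trunc K V)
    (@nprod_vacl K V) (@nprod_borcherds K V).

Section Pullback.
Variables (U V : vertexAlgType K) (f : U -> V) (hf : is_va_hom f).
Variables (M : lmodType K) (act : vaModule V M).

Let pact a n m := act (f a) n m.

Fact pull_linearl n m : linear (fun a => pact a n m).
Proof. by case: hf => lf _ _ c a b; rewrite /pact lf mode_linearl. Qed.
Fact pull_linearr a n : linear (pact a n).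
Proof. by move=> c u w; rewrite /pact mode_linearr. Qed.
Fact pull_trunc : truncation pact.
Proof. by move=> a c; apply: mode_trunc. Qed.
Fact pull_vac n m : pact vac n m = if n == -1 then m else 0.
Proof. by case: hf => _ f1 _; rewrite /pact f1 mode_vac. Qed.
Fact pull_borcherds : borcherds_identity (@nprod K U) pact.
Proof.
case: hf => lf _ fM a b c l m n N HN; rewrite /pact.
under eq_bigr do rewrite fM.
by apply: mode_borcherds => i /HN[E1 E2 E3]; split=> //; rewrite -fM E1 (lin0 lf).
Qed.

Definition pullmod : vaModule U M :=
  VaModule pull_linearl pull_linearr pull_trunc pull_vac pull_borcherds.

End Pullback.

Section Translation.
Variable V : vertexAlgType K.
Implicit Types a b : V.

(** Apply Borcherds to the vacuum with (l, m, n) = (n, 0, -2): the two surviving terms on the right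
    are a_(n) Db and -n a_(n-1) b = (Da)_(n) b. *)
Lemma vaD_nprod a b n : vaD (nprod a n b) = nprod a n (vaD b) + nprod (vaD a) n b.
Proof.
have [N0 /(_ N0.+2)] := borcherds_large (regmod V) a b vac n 0 (-2).
rewrite big_ord_recl big1 ?addr0 => [|i _]; last by rewrite (@binz_gt _ 0) // scale0r.
rewrite 2!big_ord_recl big1 ?addr0 => [|i _]; last first.
  rewrite /= /bump /= !add0r nprod_vacr0 (lin0 (nprod_linearr _ _)) scaler0 subr0.
  have -> : -2 + (1 + (1 + i))%N%:Z = i%:Z by lia.
  by rewrite nprod_vacr0 (lin0 (nprod_linearr _ _)) scaler0.
rewrite /= !binz0 binz1 expr0 expr1 mulN1r mul1r !scale1r /bump /= add1n ?add0r.
rewrite (_ : -2 + 1 = -1) // !nprod_vacr (@nprod_vacr0 _ _ _ 0) (@nprod_vacr0 _ _ _ 1).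
rewrite !(lin0 (nprod_linearr _ _)) !scaler0 !subr0 => E.
rewrite /vaD E; last by lia.
congr (_ + _).
exact/esym/(act_vaD (regmod V)).
Qed.

(** Skew-symmetry, with the creation modes c_(-1-i) vac in place of the divided powers D^i c / i!.
    It turns left ideals into two-sided ones. *)
Lemma nprod_skew a b n : exists N, nprod b n a = - ((-1) ^ n)^-1 *:
  \sum_(i < N) binz K (-1) i *: nprod (nprod a (n + i%:Z) b) (-1 - i%:Z) vac.
Proof.
have [N0 /(_ N0.+1)] := borcherds_large (regmod V) a b vac n (-1) 0.
rewrite [X in _ = X]big_ord_recl [X in _ = _ + X]big1 ?addr0 => [|i _]; last first.
  rewrite /= !add0r nprod_vacr0 (lin0 (nprod_linearr _ _)).
  have -> : -1 + (bump 0 i)%:Z = i%:Z by rewrite /bump /=; lia.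
  by rewrite nprod_vacr0 (lin0 (nprod_linearr _ _)) scaler0 subr0 scaler0.
rewrite /= nprod_vacr (@nprod_vacr0 _ _ _ 0) (lin0 (nprod_linearr _ _)) sub0r.
rewrite binz0 mulr1 scale1r => E; exists N0.+1.
by rewrite E // scalerN scaleNr opprK scalerA mulVf ?scale1r // expfz_neq0 // oppr_eq0 oner_eq0.
Qed.

End Translation.

End RegularModule.

(** * Words in the generators and the L(0)-grading *)

(* Rescaled generators, for which all structure constants are integers: *)
(* 0, 1, 2, 3 stand for 3 J, 6 T, G^+, 9 G^-, with weights 1, 2, 1, 2 *)
(* with respect to the shifted L(0).  A word lists modes X_(n) applied to the vacuum. *)
Definition word := seq (nat * int).

Definition gwt (g : nat) : nat := if g is (0 | 2)%N then 1%N else 2%N.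

Definition wwt (w : word) : int :=
  foldr (fun p s => (gwt p.1)%:Z - p.2 - 1 + s) 0 w.

Lemma wwt_cons p w : wwt (p :: w) = (gwt p.1)%:Z - p.2 - 1 + wwt w.
Proof. by []. Qed.

Definition negw (w : word) := all (fun p : nat * int => p.2 < 0) w.

Lemma wwt_ge0 w : negw w -> 0 <= wwt w.
Proof.
elim: w => [|[g n] w IHw] //=.
by move=> /andP[n0 /IHw]; rewrite /gwt; case: g => [|[|[|]]]; lia.
Qed.

Lemma wwt_cons_gt p w : negw (p :: w) -> wwt w < wwt (p :: w).
Proof.
case: p => g n /= /andP[/= n0 _]; rewrite /gwt.
by case: g => [|[|[|]]]; lia.
Qed.

Section BershadskyPolyakov.
Variables (K : numFieldType) (W : vertexAlgType K) (J T Gp Gm : W).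
Hypothesis ope : BP_OPEs (- (5 / 3)) J T Gp Gm.
Hypothesis gen : strongly_generated [:: J; T; Gp; Gm].

Definition gv (g : nat) : W :=
  match g with 0 => 3 *: J | 1 => 6 *: T | 2 => Gp | _ => 9 *: Gm end%N.

Definition ev (w : word) : W := foldr (fun p b => nprod (gv p.1) p.2 b) vac w.

Lemma va_monomial_ev (s : seq (W * nat)) :
  all (fun p => p.1 \in [:: J; T; Gp; Gm]) s ->
  exists c w, negw w /\ va_monomial s = c *: ev w.
Proof.
elim: s => [|[X n] s IHs] /=; first by exists 1, [::]; rewrite scale1r.
move=> /andP[HX /IHs[c [w [nw ->]]]].
have [d [g ->]] : exists d g, X = d *: gv g.
  move: HX; rewrite !inE => /or4P[] /eqP->.
  - by exists 3^-1, 0%N; rewrite /= scalerA mulVf ?scale1r ?pnatr_eq0.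
  - by exists 6^-1, 1%N; rewrite /= scalerA mulVf ?scale1r ?pnatr_eq0.
  - by exists 1, 2%N; rewrite scale1r.
  - by exists 9^-1, 3%N; rewrite /= scalerA mulVf ?scale1r ?pnatr_eq0.
exists (d * c), ((g, - n%:Z - 1) :: w); split; first by rewrite /= nw andbT; lia.
by rewrite (linZ (nprod_linearr _ _)) (linZ (nprod_linearl _ _)) scalerA mulrC.
Qed.

Lemma span_words (P : set W) : subspace P -> (forall w, negw w -> P (ev w)) -> forall b, P b.
Proof.
move=> sP Pw b; have : setT b by [].
rewrite -gen; apply: (span_sub sP) => _ /= [s Hs <-].
by have [c [w [/Pw ? ->]]] := va_monomial_ev Hs; apply: subspaceZ.
Qed.

Lemma words_combination b : exists n (c : 'I_n -> K) (w : 'I_n -> word),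
  (forall i, negw (w i)) /\ b = \sum_(i < n) c i *: ev (w i).
Proof.
suff: Defs.span [set ev w | w in [set w | negw w]] b.
  move=> [n [c [e [He ->]]]].
  have /choice[w Hw] : forall i, exists w, negw w /\ ev w = e i.
    by move=> i; have [w] := He i; exists w.
  exists n, c, w; split=> [i|]; first by have [] := Hw i.
  by apply: eq_bigr => i _; have [_ ->] := Hw i.
apply: span_words => [|w nw]; first exact: span_subspace.
by apply: span_incl; exists w.
Qed.

Section L0.
Variables (M : lmodType K) (act : vaModule W M).

(** The operator L(0) of the vector T + DJ/2, since (DJ)_(1) = - J_(0). The shift moves the weights
    3/2 of G^+ and G^- to 1 and 2, making the grading of W integral. *)
Definition L0 (m : M) : M := act T 1 m - 2^-1 *: act J 0 m.

Lemma L0_linear : linear L0.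
Proof.
move=> c u w; rewrite /L0 !mode_linearr scalerDr scalerBr !scalerA [_ * c]mulrC.
by rewrite opprD addrACA.
Qed.

End L0.

Notation eigW := (eig (L0 (regmod W))).

(** Both T_(0) and D are derivations of all n-th products, kill the vacuum and agree on the
    generators by the OPEs. *)
Lemma T0_vaD b : nprod T 0 b = vaD b.
Proof.
have TX X : X \in [:: J; T; Gp; Gm] -> nprod T 0 X = vaD X.
  by rewrite !inE => /or4P[] /eqP->;
    [have := ope_TJ ope 0 | have := ope_TT ope 0 | have := ope_TGp ope 0 | have := ope_TGm ope 0].
have Tg g : nprod T 0 (gv g) = vaD (gv g).
  have Z c X : X \in [:: J; T; Gp; Gm] -> nprod T 0 (c *: X) = vaD (c *: X).
    move=> /TX E; rewrite (linZ (nprod_linearr _ _)) E.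
    by rewrite /vaD (linZ (nprod_linearl _ _)).
  case: g => [|[|[|g]]]; rewrite /gv.
  - by apply: Z; rewrite !inE eqxx.
  - by apply: Z; rewrite !inE eqxx orbT.
  - by apply: TX; rewrite !inE eqxx !orbT.
  - by apply: Z; rewrite !inE eqxx !orbT.
apply: (@span_words [set b | nprod T 0 b = vaD b]) => [|w _].
  split=> [|c u w /= Hu Hw]; last first.
    by rewrite nprod_linearr Hu Hw /vaD nprod_linearl.
  by rewrite /= /vaD (lin0 (nprod_linearr _ _)) (lin0 (nprod_linearl _ _)).
elim: w => [|[g n] w IHw] /=; first by rewrite (@nprod_vacr0 _ _ _ 0) /vaD nprod_vacl.
by have /= -> := commutator0 (regmod W) T (gv g) (ev w) n; rewrite IHw Tg vaD_nprod.
Qed.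

(** In [T_(1), b_(n)] the term (T_(0) b)_(n+1) = (Db)_(n+1) contributes -(n+1) b_(n); the J_(0)
    parts of the two sides cancel. *)
Lemma eig_mode (M : lmodType K) (act : vaModule W M) d mu b m n :
  eigW d b -> eig (L0 act) mu m -> eig (L0 act) (d - n%:~R - 1 + mu) (act b n m).
Proof.
rewrite /eig /L0 /= => Hb Hm.
rewrite commutator1 commutator0 T0_vaD act_vaD addrK.
have -> : nprod T 1 b = d *: b + 2^-1 *: nprod J 0 b by rewrite -Hb subrK.
rewrite actDl !actZl scalerDr.
have -> : act T 1 m = mu *: m + 2^-1 *: act J 0 m by rewrite -Hm subrK.
rewrite (linD (mode_linearr act b n)) !actZr.
apply/eqP; rewrite subr_eq [_ + _ *: act b n (act J 0 m) + _]addrAC addrACA.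
by apply/eqP; congr (_ + _); rewrite -!scalerDl; congr (_ *: _); rewrite rmorphD /=; ring.
Qed.

(** The OPEs list T with J but not J with T. Commuting T_(-1) and J_(0) on the vacuum gives J_(0) T,
    as the contributions DJ and -DJ cancel. *)
Lemma J0_T : nprod J 0 T = 0.
Proof.
have TJ i : (2 <= i)%N -> nprod T i%:Z J = 0.
  by move=> Hi; rewrite (ope_TJ ope) nth_default.
have := commutator (regmod W) vac (-1) 0 TJ.
rewrite big_ord_recl big_ord1 binz0 binz1 scale1r scaleN1r.
rewrite /= (ope_TJ ope 0) (ope_TJ ope 1) nprod_vacr !(@nprod_vacr0 _ _ _ 0) /= !subr0.
by rewrite (lin0 (nprod_linearr _ _)) nprod_vacr subrr addr0 => <-.
Qed.

Lemma eig_gv g : eigW (gwt g)%:R (gv g).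
Proof.
have JT := J0_T.
have JJ : nprod J 0 J = 0 := ope_JJ ope 0.
have TJ : nprod T 1 J = J := ope_TJ ope 1.
have JG : nprod J 0 Gp = Gp := ope_JGp ope 0.
have JG' : nprod J 0 Gm = - Gm := ope_JGm ope 0.
have TG : nprod T 1 Gp = (3 / 2) *: Gp := ope_TGp ope 1.
have TG' : nprod T 1 Gm = (3 / 2) *: Gm := ope_TGm ope 1.
have TT : nprod T 1 T = 2 *: T := ope_TT ope 1.
have lin := L0_linear (regmod W).
have Z c b mu : eigW mu b -> eigW mu (c *: b).
  exact: (subspaceZ (eig_subspace lin mu)).
case: g => [|[|[|g]]]; rewrite /gwt /gv; try apply: (Z); rewrite /eig /L0 /=.
- by rewrite TJ JJ scaler0 subr0 scale1r.
- by rewrite TT JT scaler0 subr0.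
- by rewrite TG JG -scalerBl scale1r (_ : 3 / 2 - 2^-1 = 1) ?scale1r //; field.
- by rewrite TG' JG' scalerN opprK -scalerDl; congr (_ *: _); field.
Qed.

Lemma eig_ev w : eigW (wwt w)%:~R (ev w).
Proof.
elim: w => [|[g n] w IHw].
  by rewrite /eig /L0 /= (@nprod_vacr0 _ _ _ 1) (@nprod_vacr0 _ _ _ 0) scaler0 subr0 scale0r.
rewrite wwt_cons rmorphD !rmorphB /=.
exact: (eig_mode (act := regmod W) n (eig_gv g) IHw).
Qed.

(** Expand b in words and remove those of weight d: what is left has weight d but is a sum of
    vectors of other weights, hence is zero. *)
Lemma eig_span_words (d : int) (P : set W) b : subspace P ->
  (forall w, negw w -> wwt w = d -> P (ev w)) -> eigW d%:~R b -> P b.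
Proof.
move=> sP Pw Hb; have [n [c [w [nw def_b]]]] := words_combination b.
have lin := L0_linear (regmod W).
pose b1 := \sum_(i < n) (if wwt (w i) == d then c i else 0) *: ev (w i).
suff -> : b = b1.
  apply: (subspace_sum sP) => i _; case: eqP => E; first exact/(subspaceZ sP)/Pw.
  by rewrite scale0r; apply: subspace0.
apply/eqP; rewrite -subr_eq0; apply/eqP.
(* Removed words leave zero terms, which may be given any eigenvalue other than d; d + 1 serves. *)
pose lam i : K := if wwt (w i) == d then (d + 1)%:~R else (wwt (w i))%:~R.
apply: (@eig_sum_eq0 _ _ _ lin n lam (fun i => (if wwt (w i) == d then 0 else c i) *: ev (w i)) d%:~R).
- move=> i; rewrite /lam; case: eqP => [_|/eqP ne].
    by rewrite scale0r; split; [exact: (subspace0 (eig_subspace lin _)) | rewrite eqr_int; lia].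
  by split; [exact/(subspaceZ (eig_subspace lin _))/eig_ev | rewrite eqr_int].
- apply: (subspaceB (eig_subspace lin _)) => //; apply: (subspace_sum (eig_subspace lin _)) => i _.
  case: eqP => [<-|_]; first exact/(subspaceZ (eig_subspace lin _))/eig_ev.
  by rewrite scale0r; apply: (subspace0 (eig_subspace lin _)).
- rewrite {1}def_b /b1 -sumrB; apply: eq_bigr => i _.
  by case: eqP; rewrite scale0r ?subrr ?subr0.
Qed.

Lemma eig_neg (d : int) b : d < 0 -> eigW d%:~R b -> b = 0.
Proof.
move=> d0; apply: (eig_span_words (P := [set 0])).
  by split=> //= c u w -> ->; rewrite scaler0 addr0.
by move=> w /wwt_ge0 + E; rewrite E; lia.
Qed.

Section Grading.
Variables (M : lmodType K) (act : vaModule W M).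
Let lin := L0_linear act.

Definition graded_above (h : K) : set M :=
  Defs.span [set m | exists i : nat, eig (L0 act) (h + i%:R) m].

Lemma graded_above_eig0 h mu m : (forall i : nat, h + i%:R != mu) ->
  graded_above h m -> eig (L0 act) mu m -> m = 0.
Proof.
move=> Hmu [n [c [e [/choice[k Hk] def_m]]]] Hm.
apply: (@eig_sum_eq0 _ _ _ lin n (fun i => h + (k i)%:R) (fun i => c i *: e i) mu) => // i.
by split=> //; apply/(subspaceZ (eig_subspace lin _))/Hk.
Qed.

Variable v : M.
Hypothesis v_low : forall g n, (gwt g)%:Z <= n -> act (gv g) n v = 0.

(** Induction on the weight. For a word X_(l) w, [zhu_identity] trades its mode for modes of X_(l+i)
    w with i >= 1, of weight d - i. These products are homogeneous but need not be words with
    negative modes, so the statement is about eigenvectors. *)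
Lemma lowest_kill (d : int) b n : eigW d%:~R b -> d <= n -> act b n v = 0.
Proof.
have [k] : exists k : nat, d < k%:Z by exists `|d|.+1; lia.
elim: k => [|k IHk] in d b n * => dk Hb dn.
  by rewrite (eig_neg _ Hb) ?act0l.
apply: (@eig_span_words d [set b | forall n, d <= n -> act b n v = 0]) Hb n dn.
  split=> [n _|c u w Hu Hw n dn]; first by rewrite act0l.
  by rewrite mode_linearl Hu // Hw // scaler0 addr0.
case=> [|[g l] w] nw wd n dn.
  by rewrite /= mode_vac ifF //; apply/eqP; move: dn; rewrite -wd /wwt /=; lia.
have ld := wwt_cons_gt nw; rewrite wd in ld; have Ew := eig_ev w.
move: nw wd; rewrite wwt_cons /= => /andP[l0 _] wd.
have [j Ej] : exists j : nat, l = - j.+1%:Z by exists `|(l + 1)%R|%N; lia.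
have := @zhu_identity _ _ _ act (gwt g) (n - (gwt g)%:Z - j%:Z + 1) j (gv g) (ev w) v isT (@v_low g).
have Bv i : n - (gwt g)%:Z - j%:Z <= i -> act (ev w) i v = 0.
  by move=> Hi; apply: (IHk (wwt w)) => //; lia.
rewrite big_ord_recl big1 ?addr0 => [|[i lti] _]; last first.
  rewrite (IHk (d - (lift ord0 (Ordinal lti))%:Z)) ?scaler0 //=; rewrite /bump /=; [lia| |lia].
  have E := eig_mode (act := regmod W) (- j.+1%:Z + (1 + i)%N%:Z) (eig_gv g) Ew.
  rewrite (_ : d - _ = (gwt g)%:Z - (- j.+1%:Z + (1 + i)%N%:Z) - 1 + wwt w); last by lia.
  by rewrite rmorphD !rmorphB; apply: E.
rewrite /= -Ej binz0 scale1r (_ : (gwt g)%:Z + _ = n); last by lia.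
move=> -> ; last by move=> i Hi; apply: Bv; lia.
(* For j = 0 the right side of [zhu_identity] contains the mode of w one below the cutoff used
   there; it still kills v because [Bv] holds from that index on. *)
by case: (j) => //; rewrite Bv ?act0r //; lia.
Qed.

(** A mode b_(n) v with b of weight d has weight h + d - n - 1, and vanishes unless d > n. *)
Lemma span_modes_graded h : eig (L0 act) h v ->
  Defs.span [set m | exists b n, m = act b n v] `<=` graded_above h.
Proof.
have sG : subspace (graded_above h) by apply: span_subspace.
move=> Hv; apply: (span_sub sG) => _ [b [n ->]].
have [k [c [w [nw ->]]]] := words_combination b.
rewrite (lin_sum (mode_linearl act n v)); apply: (subspace_sum sG) => i _.
rewrite actZl; apply: (subspaceZ sG).
have [le|gt] := lerP (wwt (w i)) n.
  by rewrite (lowest_kill (eig_ev _) le); apply: subspace0.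
apply: span_incl; exists `|(wwt (w i) - n - 1)%R|%N.
have := eig_mode (act := act) n (eig_ev (w i)) Hv.
congr (eig _ _ _); rewrite addrC; congr (_ + _).
by rewrite -!rmorphB -[1]/(1%:~R) -rmorphB -[RHS]/(_%:Z%:~R) gez0_abs //; lia.
Qed.

End Grading.

End BershadskyPolyakov.

(** * Commutators and normal ordering at k = -5/3 *)

Section Commutators.
Variables (K : numFieldType) (W : vertexAlgType K) (J T Gp Gm : W).
Hypothesis ope : BP_OPEs (- (5 / 3)) J T Gp Gm.
Variables (M : lmodType K) (act : vaModule W M).
Local Notation gv := (gv J T Gp Gm).
Local Notation bracket g n h m c := (act (gv g) n (act (gv h) m c) - act (gv h) m (act (gv g) n c)).

Lemma comm_OPE a b s x y c n m : OPE a b s ->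
  act (x *: a) n (act (y *: b) m c) - act (y *: b) m (act (x *: a) n c)
  = (x * y) *: \sum_(i < size s) binz K n i *: act s`_i (n + m - i%:Z) c.
Proof.
move=> Hs; rewrite !(actZl, actZr) !scalerA [y * x]mulrC -scalerBr; congr (_ *: _).
rewrite (commutator (k := size s) act) => [|i Hi]; last by rewrite Hs nth_default.
by rewrite addrAC subrr add0r; apply: eq_bigr => i _; rewrite Hs.
Qed.

Lemma act_vac p c : act vac p c = (p == -1)%:R *: c.
Proof. by rewrite mode_vac; case: eqP; rewrite ?scale1r ?scale0r. Qed.

Lemma comm_aa n m c : bracket 0%N n 0%N m c = (- n%:~R * (n + m == 0)%:R) *: c.
Proof.
rewrite (comm_OPE _ _ _ _ _ (ope_JJ ope)) big_ord_recl big_ord1 /= act0l scaler0 add0r /bump /=.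
rewrite binz1 actZl act_vac (_ : (n + m - _ == -1) = (n + m == 0)); last by apply/eqP/eqP; lia.
by rewrite !scalerA; congr (_ *: _); field.
Qed.

Lemma comm_ta n m c : bracket 1%N n 0%N m c = (- 6 * m%:~R) *: act (gv 0) (n + m - 1) c.
Proof.
rewrite (comm_OPE _ _ _ _ _ (ope_TJ ope)) big_ord_recl big_ord1 /= subr0 act_vaD.
rewrite binz0 binz1 actZl scale1r /bump /= -scalerDl !scalerA rmorphD /=.
by congr (_ *: _); ring.
Qed.

Lemma comm_ae n m c : bracket 0%N n 2%N m c = 3 *: act (gv 2) (n + m) c.
Proof.
rewrite -[gv 2]scale1r (comm_OPE _ _ _ _ _ (ope_JGp ope)) big_ord1 /= subr0 scale1r.
by rewrite binz0 scale1r mulr1.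
Qed.

Lemma comm_af n m c : bracket 0%N n 3%N m c = - 3 *: act (gv 3) (n + m) c.
Proof.
rewrite (comm_OPE _ _ _ _ _ (ope_JGm ope)) big_ord1 /= subr0 actNl.
by rewrite binz0 scale1r actZl scalerA scalerN -scaleNr; congr (_ *: _); ring.
Qed.

(** The central charge is -1 at this level, so the central term is 36 C(n,3) (-1/2). *)
Lemma comm_tt n m c : bracket 1%N n 1%N m c =
  (6 * (n - m)%:~R) *: act (gv 1) (n + m - 1) c
  - (3 * (n * (n - 1) * (n - 2))%:~R * (n + m == 2)%:R) *: c.
Proof.
rewrite (comm_OPE _ _ _ _ _ (ope_TT ope)) 3!big_ord_recl big_ord1 /= subr0 act_vaD.
rewrite act0l scaler0 add0r !actZl act_vac /bump /=.
rewrite (_ : (n + m - _ == -1) = (n + m == 2)); last by apply/eqP/eqP; lia.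
rewrite !binzS !binz0 /central_charge !addrA !scalerDr !scalerA -scalerDl -scaleNr rmorphD rmorphB /=.
congr (_ *: _ + _ *: _); first by field.
by rewrite !rmorphM !rmorphB /=; field.
Qed.

Lemma comm_te n m c : bracket 1%N n 2%N m c = (3 * n - 6 * m)%:~R *: act (gv 2) (n + m - 1) c.
Proof.
rewrite -[gv 2]scale1r (comm_OPE _ _ _ _ _ (ope_TGp ope)) big_ord_recl big_ord1 /= subr0 act_vaD scale1r.
rewrite binz0 binz1 actZl scale1r scalerA /bump /= -scalerDl !scalerA rmorphB rmorphD !rmorphM /=.
by congr (_ *: _); field.
Qed.

Lemma comm_tf n m c : bracket 1%N n 3%N m c = (3 * n - 6 * m)%:~R *: act (gv 3) (n + m - 1) c.
Proof.
rewrite (comm_OPE _ _ _ _ _ (ope_TGm ope)) big_ord_recl big_ord1 /= subr0 act_vaD.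
rewrite binz0 binz1 !actZl scale1r /bump /= !scalerA -scalerDl !scalerA rmorphB rmorphD !rmorphM /=.
by congr (_ *: _); field.
Qed.

Lemma comm_ee n m c : bracket 2%N n 2%N m c = 0.
Proof.
by rewrite -[gv 2]scale1r (comm_OPE _ _ _ _ _ (ope_GpGp ope)) big_ord0 scaler0.
Qed.

Lemma comm_ff n m c : bracket 3%N n 3%N m c = 0.
Proof. by rewrite (comm_OPE _ _ _ _ _ (ope_GmGm ope)) big_ord0 scaler0. Qed.

Lemma comm_ef n m c : bracket 2%N n 3%N m c =
  3 *: act (nprod (gv 0) (-1) (gv 0)) (n + m) c + (3 * (m - n)%:~R) *: act (gv 0) (n + m - 1) c
  - 2 *: act (gv 1) (n + m) c + ((n * (n - 1))%:~R * (n + m == 1)%:R) *: c.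
Proof.
rewrite -[gv 2]scale1r (comm_OPE _ _ _ _ _ (ope_GpGm ope)) 2!big_ord_recl big_ord1 /= subr0.
rewrite (linZ (nprod_linearr _ _)) (linZ (nprod_linearl _ _)) !actDl actNl !actZl.
rewrite act_vaD act_vac /bump /=.
rewrite (_ : (n + m - _ == -1) = (n + m == 1)); last by apply/eqP/eqP; lia.
rewrite !binzS !binz0 !addrA !scalerDr !scalerN !scalerA.
rewrite [_ - _ + _ *: act J _ _]addrAC -[_ + _ + _ *: act J _ _]addrA -scalerDl.
congr (_ *: _ + _ *: _ - _ *: _ + _ *: _); first by field.
- by rewrite rmorphB rmorphD /=; field.
- by field.
by rewrite rmorphM rmorphB /=; field.
Qed.

End Commutators.

(** * Symbolic normal ordering of words *)

Definition lcomb (X : Type) := seq (Z * X).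

Definition lscale X (c : Z) (L : lcomb X) : lcomb X := [seq (c * p.1, p.2) | p <- L].

Definition lbind X Y (f : X -> lcomb Y) (L : lcomb X) : lcomb Y :=
  flatten [seq lscale p.1 (f p.2) | p <- L].

Section Engine.
Variable ap : nat -> int -> word -> lcomb word.

(** The p-th mode of the normally ordered square of 3J on w, expanded as in [act_normal_product].
    Past the cutoff both annihilating modes would send w to negative weight. *)
Definition ap_aa (p : int) (w : word) : lcomb word :=
  flatten [seq lbind (ap 0%N (-1 - j%:Z)) (ap 0%N (p + j%:Z) w)
            ++ lbind (ap 0%N (p - 1 - j%:Z)) (ap 0%N j%:Z w)
          | j <- iota 0 (`|wwt w| + `|p| + 3)].

Definition lcomm_ef (n m : int) (w : word) : lcomb word :=
  lscale 3 (ap_aa (n + m) w) ++ lscale (Z_of_int (3 * (m - n))) (ap 0%N (n + m - 1) w)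
  ++ lscale (- 2) (ap 1%N (n + m) w)
  ++ (if n + m == 1 then [:: (Z_of_int (n * (n - 1)), w)] else [::]).

Definition lcomm (g : nat) (n : int) (h : nat) (m : int) (w : word) : lcomb word :=
  match g, h with
  | 0%N, 0%N => if n + m == 0 then [:: (Z_of_int (- n), w)] else [::]
  | 0%N, 1%N => lscale (Z_of_int (6 * n)) (ap 0%N (n + m - 1) w)
  | 1%N, 0%N => lscale (Z_of_int (- 6 * m)) (ap 0%N (n + m - 1) w)
  | 0%N, 2%N => lscale 3 (ap 2%N (n + m) w)
  | 2%N, 0%N => lscale (- 3) (ap 2%N (n + m) w)
  | 0%N, _ => lscale (- 3) (ap 3%N (n + m) w)
  | _, 0%N => lscale 3 (ap 3%N (n + m) w)
  | 1%N, 1%N => lscale (Z_of_int (6 * (n - m))) (ap 1%N (n + m - 1) w)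
      ++ (if n + m == 2 then [:: (Z_of_int (- 3 * (n * (n - 1) * (n - 2))), w)] else [::])
  | 1%N, 2%N => lscale (Z_of_int (3 * n - 6 * m)) (ap 2%N (n + m - 1) w)
  | 2%N, 1%N => lscale (Z_of_int (6 * n - 3 * m)) (ap 2%N (n + m - 1) w)
  | 1%N, _ => lscale (Z_of_int (3 * n - 6 * m)) (ap 3%N (n + m - 1) w)
  | _, 1%N => lscale (Z_of_int (6 * n - 3 * m)) (ap 3%N (n + m - 1) w)
  | 2%N, 2%N => [::]
  | 2%N, _ => lcomm_ef n m w
  | _, 2%N => lscale (- 1) (lcomm_ef m n w)
  | _, _ => [::]
  end.

End Engine.

Definition ordered (g : nat) (n : int) (h : nat) (m : int) : bool :=
  (g < h)%N || (g == h) && (n <= m).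

(* Normal ordering of X_(n) w.  The result is a correct expansion whatever the *)
(* fuel; running out of it only leaves words that are not ordered.              *)
Fixpoint lmode (fuel : nat) (g : nat) (n : int) (w : word) : lcomb word :=
  if fuel is f.+1 then
    if (gwt g)%:Z - n - 1 + wwt w < 0 then [::] else
    match w with
    | [::] => if 0 <= n then [::] else [:: (1, [:: (g, n)])]
    | (h, m) :: w1 =>
        if (n < 0) && ordered g n h m then [:: (1, (g, n) :: w)]
        else lbind (lmode f h m) (lmode f g n w1) ++ lcomm (lmode f) g n h m w1
    end
  else [:: (1, (g, n) :: w)].

Section Merge.
Variable X : eqType.

Definition lmerge (c : Z) (w : X) : lcomb X -> lcomb X :=
  fix mrg L := if L is (c', w') :: L' then
    if w == w' then (c + c', w) :: L' else (c', w') :: mrg L' else [:: (c, w)].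

Definition lnorm (L : lcomb X) : lcomb X :=
  [seq p <- foldr (fun p => lmerge p.1 p.2) [::] L | p.1 != 0].

End Merge.

Section Values.
Variable K : numFieldType.

Definition zk (z : Z) : K := (int_of_Z z)%:~R.

Lemma zkM a b : zk (a * b) = zk a * zk b. Proof. by rewrite /zk !rmorphM. Qed.
Lemma zkD a b : zk (a + b) = zk a + zk b. Proof. by rewrite /zk !rmorphD. Qed.
Lemma zkN a : zk (- a) = - zk a. Proof. by rewrite /zk !rmorphN. Qed.
Lemma zk_int n : zk (Z_of_int n) = n%:~R. Proof. by rewrite /zk Z_of_intK. Qed.

Section LinearCombination.
Variables (X : Type) (M : lmodType K) (phi : X -> M).

Definition lval (L : lcomb X) : M := \sum_(p <- L) zk p.1 *: phi p.2.

Lemma lval0 : lval [::] = 0. Proof. exact: big_nil. Qed.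

Lemma lval1 c w : lval [:: (c, w)] = zk c *: phi w. Proof. exact: big_seq1. Qed.

Lemma lval_cons p L : lval (p :: L) = zk p.1 *: phi p.2 + lval L.
Proof. exact: big_cons. Qed.

Lemma lval_cat L1 L2 : lval (L1 ++ L2) = lval L1 + lval L2.
Proof. exact: big_cat. Qed.

Lemma lval_scale c L : lval (lscale c L) = zk c *: lval L.
Proof.
by rewrite /lval big_map scaler_sumr; apply: eq_bigr => p _; rewrite zkM scalerA.
Qed.

Lemma lval_flatten (I : Type) (r : seq I) (F : I -> lcomb X) :
  lval (flatten [seq F i | i <- r]) = \sum_(i <- r) lval (F i).
Proof. by rewrite /lval big_flatten big_map. Qed.

End LinearCombination.

Lemma lval_bind (X Y : Type) (M N : lmodType K) (phi : X -> M) (psi : Y -> N)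
    (h : M -> N) (f : X -> lcomb Y) L :
  linear h -> (forall w, lval psi (f w) = h (phi w)) ->
  lval psi (lbind f L) = h (lval phi L).
Proof.
move=> lh Hf; rewrite lval_flatten [lval phi L]/lval (lin_sum lh).
by apply: eq_bigr => p _; rewrite lval_scale Hf (linZ lh).
Qed.

Lemma lval_lnorm (X : eqType) (M : lmodType K) (phi : X -> M) L :
  lval phi (lnorm L) = lval phi L.
Proof.
have Em c w L' : lval phi (lmerge c w L') = zk c *: phi w + lval phi L'.
  elim: L' => [|[c' w'] L' IHL] /=; first by rewrite lval1 lval0 addr0.
  case: eqP => [->|_]; first by rewrite !lval_cons /= zkD scalerDl addrA.
  by rewrite !lval_cons IHL addrCA.
transitivity (lval phi (foldr (fun p => lmerge p.1 p.2) [::] L)).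
  rewrite /lval big_filter [RHS](bigID (fun p => p.1 != 0)) /= [X in _ = _ + X]big1 ?addr0 //.
  by move=> p /negPn/eqP->; rewrite /zk !rmorph0 scale0r.
by elim: L => [|p L IHL] //=; rewrite Em IHL lval_cons.
Qed.

End Values.

Section EngineSound.
Variables (K : numFieldType) (W : vertexAlgType K) (J T Gp Gm : W).
Hypothesis ope : BP_OPEs (- (5 / 3)) J T Gp Gm.
Hypothesis gen : strongly_generated [:: J; T; Gp; Gm].
Local Notation gv := (gv J T Gp Gm).
Local Notation ev := (ev J T Gp Gm).
Local Notation eigW := (eig (L0 J T (regmod W))).

Local Notation evl := (lval ev).
Local Notation zk := (zk K).

Lemma ev_mode_neg g n w : (gwt g)%:Z - n - 1 + wwt w < 0 -> nprod (gv g) n (ev w) = 0.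
Proof.
by move=> lt0; apply: (eig_neg ope gen lt0); apply: (eig_ev ope gen ((g, n) :: w)).
Qed.

Lemma nprod_aa_ev p w :
  nprod (nprod (gv 0) (-1) (gv 0)) p (ev w) =
  \sum_(j < `|wwt w| + `|p| + 3) (nprod (gv 0) (-1 - j%:Z) (nprod (gv 0) (p + j%:Z) (ev w))
     + nprod (gv 0) (p - 1 - j%:Z) (nprod (gv 0) j%:Z (ev w))).
Proof.
have := @act_normal_product _ _ _ (regmod W) (`|wwt w| + `|p| + 3) (gv 0) (gv 0) p (ev w).
apply=> i Hi; split.
- rewrite /= (linZ (nprod_linearr _ _)) (linZ (nprod_linearl _ _)).
  have -> : -1 + i%:Z = i.-1%:Z by lia.
  by rewrite (ope_JJ ope) nth_default ?scaler0 //=; lia.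
- by apply: (@ev_mode_neg 0); rewrite /=; lia.
- by apply: (@ev_mode_neg 0); rewrite /=; lia.
Qed.

Section Step.
Variable ap : nat -> int -> word -> lcomb word.
Hypothesis apE : forall g n w, evl (ap g n w) = nprod (gv g) n (ev w).

Lemma evl_ap_bind g n L : evl (lbind (ap g n) L) = nprod (gv g) n (evl L).
Proof. by apply: (lval_bind (h := nprod (gv g) n)) => //; apply: nprod_linearr. Qed.

Lemma evl_ap_aa p w : evl (ap_aa ap p w) = nprod (nprod (gv 0) (-1) (gv 0)) p (ev w).
Proof.
rewrite lval_flatten nprod_aa_ev -{1}[(_ + 3)%N]subn0 -/(index_iota 0 _) big_mkord.
by apply: eq_bigr => j _; rewrite lval_cat !evl_ap_bind !apE.
Qed.

(** Each mixed commutator was computed in one order only; antisymmetry gives the other entries of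
    [lcomm]. *)
Let brE g n h m w : nprod (gv g) n (nprod (gv h) m (ev w)) - nprod (gv h) m (nprod (gv g) n (ev w))
  = - (nprod (gv h) m (nprod (gv g) n (ev w)) - nprod (gv g) n (nprod (gv h) m (ev w))).
Proof. by rewrite opprB. Qed.

Lemma evl_if (b : bool) c w : evl (if b then [:: (c, w)] else [::]) = (zk c * b%:R) *: ev w.
Proof. by case: b; rewrite ?lval1 ?lval0 ?mulr1 ?mulr0 ?scale0r. Qed.

Lemma evl_lcomm_ef n m w : evl (lcomm_ef ap n m w) =
  nprod (gv 2) n (nprod (gv 3) m (ev w)) - nprod (gv 3) m (nprod (gv 2) n (ev w)).
Proof.
rewrite (comm_ef ope (regmod W)) !lval_cat !lval_scale evl_ap_aa !apE evl_if !zk_int !addrA.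
by congr (_ + _ *: _ + _ + _); [rewrite rmorphM | rewrite -scaleNr].
Qed.

Lemma evl_lcomm g n h m w : evl (lcomm ap g n h m w) =
  nprod (gv g) n (nprod (gv h) m (ev w)) - nprod (gv h) m (nprod (gv g) n (ev w)).
Proof.
have E := zk_int K.
case: g => [|[|[|g]]]; case: h => [|[|[|h]]]; rewrite /lcomm ?lval_scale ?apE ?E.
- rewrite (comm_aa ope (regmod W)); case: eqP; rewrite ?lval0 ?lval1 ?E.
    by rewrite mulr1 rmorphN.
  by rewrite mulr0 scale0r.
- rewrite brE (comm_ta ope (regmod W)) -scaleNr mulNr opprK rmorphM.
  by rewrite [m + n]addrC.
- by rewrite (comm_ae ope (regmod W)).
- by rewrite (comm_af ope (regmod W)).
- by rewrite (comm_ta ope (regmod W)) rmorphM.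
- rewrite lval_cat lval_scale apE evl_if !E (comm_tt ope (regmod W)) -scaleNr.
  by congr (_ *: _ + _ *: _); rewrite !rmorphM //= rmorphN -!mulNr.
- by rewrite (comm_te ope (regmod W)).
- by rewrite (comm_tf ope (regmod W)).
- by rewrite brE (comm_ae ope (regmod W)) -scaleNr [m + n]addrC.
- rewrite brE (comm_te ope (regmod W)) -scaleNr [m + n]addrC -rmorphN.
  by rewrite opprB.
- by rewrite (comm_ee ope (regmod W)) lval0.
- exact: evl_lcomm_ef.
- by rewrite brE (comm_af ope (regmod W)) -scaleNr opprK [m + n]addrC.
- rewrite brE (comm_tf ope (regmod W)) -scaleNr [m + n]addrC -rmorphN.
  by rewrite opprB.
- by rewrite brE evl_lcomm_ef zkN scaleNr [zk 1]rmorph1 scale1r.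
by rewrite (comm_ff ope (regmod W)) lval0.
Qed.
End Step.

Lemma evl_lmode fuel g n w : evl (lmode fuel g n w) = nprod (gv g) n (ev w).
Proof.
elim: fuel => [|f IHf] in g n w *; first by rewrite /= lval1 scale1r.
rewrite /=; case: ifP => [/ev_mode_neg->|_]; first exact: lval0.
case: w => [|[h m] w] /=.
  case: ifP => [|_]; last by rewrite lval1 scale1r.
  by case: n => n // _; rewrite nprod_vacr0 lval0.
case: ifP => _; first by rewrite lval1 scale1r.
by rewrite lval_cat (evl_ap_bind IHf) IHf (evl_lcomm IHf) addrC subrK.
Qed.

End EngineSound.

(** The singular vector in the rescaled generators, scaled to integer coefficients; every word has
    weight 4 and charge 0. *)
Definition Omega : lcomb word :=
  [:: (54, [:: (0, -4)]);
      (- 684, [:: (0, -3); (0, -1)]);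
      (297, [:: (0, -2); (0, -2)]);
      (324, [:: (0, -2); (0, -1); (0, -1)]);
      (- 36, [:: (0, -1); (0, -1); (0, -1); (0, -1)]);
      (138, [:: (0, -1); (0, -1); (1, -1)]);
      (- 108, [:: (0, -1); (1, -2)]);
      (- 108, [:: (0, -1); (2, -1); (3, -1)]);
      (126, [:: (1, -3)]);
      (- 31, [:: (1, -1); (1, -1)]);
      (- 18, [:: (2, -2); (3, -1)]);
      (18, [:: (2, -1); (3, -2)])].

(** * The singular vector *)

Section SingularVector.
Variables (K : numFieldType) (W : vertexAlgType K) (J T Gp Gm : W).
Hypothesis ope : BP_OPEs (- (5 / 3)) J T Gp Gm.
Hypothesis gen : strongly_generated [:: J; T; Gp; Gm].
Local Notation gv := (gv J T Gp Gm).
Local Notation ev := (ev J T Gp Gm).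

Lemma eig_lval (d : int) L : all (fun p : Z * word => wwt p.2 == d) L ->
  eig (L0 J T (regmod W)) d%:~R (lval ev L).
Proof.
have sE := eig_subspace (L0_linear J T (regmod W)) d%:~R.
move=> /allP HL; rewrite /lval big_seq; apply: (subspace_sum sE) => p /HL/eqP E.
by apply: (subspaceZ sE); rewrite -E; apply: eig_ev.
Qed.

(** Only finitely many modes need checking; for each of them normal ordering makes all terms
    cancel. *)
Lemma Omega_low g n : (gwt g)%:Z <= n -> nprod (gv g) n (lval ev Omega) = 0.
Proof.
have EO : eig (L0 J T (regmod W)) 4%:~R (lval ev Omega) by apply: eig_lval.
(* Generators have weight at most 2 and [Omega] has weight 4, so a mode with n > 5 lands in negative
   weight. *)
have [n_gt5 _|n_le5] := ltrP 5 n.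
  apply: (@eig_neg _ _ _ _ _ _ ope gen ((gwt g)%:Z - n - 1 + 4)).
    by case: g => [|[|[|]]]; rewrite /gwt; lia.
  rewrite rmorphD !rmorphB /=.
  have E := eig_mode ope gen (act := regmod W) n (eig_gv ope g) EO.
  exact: E.
have key h m : lnorm (lbind (lmode 10 h m) Omega) = [::] -> nprod (gv h) m (lval ev Omega) = 0.
  by move=> E; rewrite -(evl_ap_bind (evl_lmode ope gen 10)) -lval_lnorm E lval0.
move=> Hn; have [j Ej j5] : exists2 j : nat, n = j%:Z & (j <= 5)%N by exists `|n|%N; lia.
rewrite {n n_le5}Ej in Hn *.
case: g Hn => [|[|[|g]]] Hn; last rewrite -[gv g.+3]/(gv 3); apply: key.
all: case: j j5 Hn => [|[|[|[|[|[|j]]]]]] j5 Hn;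
  first [by move: j5 | by exfalso; move: Hn; rewrite /gwt; lia | by vm_compute].
Qed.

(** * Vanishing of the singular vector in the simple quotient *)

Section Quotient.
Variables (Wk : vertexAlgType K) (pi : W -> Wk).
Hypotheses (pi_hom : is_va_hom pi) (pi_surj : range pi = setT).

Let act := pullmod pi_hom (regmod Wk).

(** Surjectivity makes S a left ideal. It is stable under D because D is T_(0), hence under b |->
    b_(-1-i) vac, and skew-symmetry then gives the products with b on the left. *)
Lemma submodule_ideal S : submodule act S -> va_ideal S.
Proof.
move=> [sS Sact].
have Sl a n b : S b -> S (nprod a n b).
  by have [a' _ <-] : range pi a; [rewrite pi_surj | apply: Sact].
have [lpi pi1 piM] := pi_hom.
have SD b : S b -> S (vaD b).
  have [w _ <-] : range pi b by rewrite pi_surj.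
  rewrite /vaD -pi1 -piM -[nprod w _ _]/(vaD w) -(T0_vaD ope gen) piM.
  exact: Sl.
(* Induction on i, using (Db)_(-1-i) vac = (i+1) b_(-2-i) vac and dividing by i + 1. *)
have Svac i b : S b -> S (nprod b (-1 - i%:Z) vac).
  elim: i b => [|i IHi] b Sb; first by rewrite subr0 nprod_vacr.
  have : S ((i.+1)%:R^-1 *: nprod (vaD b) (-1 - i%:Z) vac).
    exact/(subspaceZ sS)/IHi/SD.
  rewrite -[nprod (vaD b) _ _]/(regmod Wk _ _ _) act_vaD scalerA.
  rewrite (_ : _ * _ = 1) ?scale1r; last first.
    rewrite -rmorphN (_ : - (-1 - i%:Z) = i.+1%:Z); last by lia.
    by rewrite mulVf // pnatr_eq0.
  by congr S; congr nprod; lia.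
split=> // a n b Sb; split; first exact: Sl.
have [N ->] := nprod_skew a b n.
apply: (subspaceZ sS); apply: (subspace_sum sS) => i _.
by apply/(subspaceZ sS)/Svac/Sl.
Qed.

(** Viewed in the W-module [Wk], the image of [Omega] generates an ideal concentrated in weights at
    least 4, which cannot contain the vacuum, of weight 0. *)
Lemma pi_Omega : simple_va Wk -> pi (lval ev Omega) = 0.
Proof.
move=> [vac_neq0 simp]; set v := pi _.
have [lpi pi1 piM] := pi_hom.
have v_low g n : (gwt g)%:Z <= n -> act (gv g) n v = 0.
  by move=> Hn; rewrite /= -piM Omega_low // (lin0 lpi).
have L0pi b : L0 J T act (pi b) = pi (L0 J T (regmod W) b).
  by rewrite /L0 /= (linB lpi) (linZ lpi) !piM.
have EO : eig (L0 J T (regmod W)) 4%:~R (lval ev Omega) by apply: eig_lval.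
have Hv : eig (L0 J T act) 4 v by rewrite /eig /= L0pi EO (linZ lpi).
have sub := submodule_span_modes act v.
have grad := span_modes_graded ope gen v_low Hv.
case: (simp _ (submodule_ideal sub)) => E.
  have : [set 0] v by rewrite -E; apply: span_incl; exists vac, (-1); rewrite mode_vac.
  by [].
(* If the ideal were everything, the vacuum would have weight 0 inside a space of weights 4 + i, and
   so be zero. *)
case: vac_neq0; apply: (@graded_above_eig0 _ _ _ _ _ act 4 0) => [i||].
- by rewrite -natrD pnatr_eq0.
- by apply: grad; rewrite E.
by rewrite /eig /= -pi1 L0pi (eig_ev ope gen [::] : L0 J T _ vac = _) !scale0r (lin0 lpi).
Qed.

End Quotient.
End SingularVector.

(** * Zero modes on top vectors *)

Arguments lmode : simpl never.

Lemma binz_bin (K : numFieldType) (m i : nat) : binz K m i = 'C(m, i)%:R.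
Proof.
elim: i => [|i IHi]; first by rewrite binz0 bin0.
have ni : i.+1%:R != 0 :> K by rewrite pnatr_eq0.
apply: (mulIf ni); rewrite binzS divfK // IHi -natrM [(_ * i.+1)%N]mulnC mul_bin_left natrM mulrC.
have [le_im|lt_mi] := leqP i m; first by rewrite subzn.
by rewrite bin_small // !mulr0.
Qed.

(* (gs, w) stands for the zero modes of the generators gs applied after the zero mode of w. *)
Definition zterm := (seq nat * word)%type.

(** One use of [zhu_words], solved for its term i = 0: the first letter splits off as a zero mode if
    it is X_(-1), and the corrections X_(-j-1+i) w, i >= 1, have lower weight. The [all] test checks
    that the computed corrections are homogeneous, so that the common mode index is the zero mode of
    each word. *)
Definition zstep (t : zterm) : lcomb zterm :=
  let: (gs, w0) := t in
  if w0 is (g, Negz j) :: w then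
    let L i := lmode 10 g (Negz j + i%:Z) w in
    if all (fun i => all (fun p : Z * word => wwt p.2 == wwt w0 - i%:Z) (L i)) (iota 1 (gwt g)) then
      (if j is 0%N then [:: (1, (rcons gs g, w))] else [::])
      ++ flatten [seq lscale (- Z_of_int 'C(gwt g, i)%:Z) [seq (p.1, (gs, p.2)) | p <- L i]
                 | i <- iota 1 (gwt g)]
    else [:: (1, t)]
  else [:: (1, t)].

Section ZhuSound.
Variables (K : numFieldType) (W : vertexAlgType K) (J T Gp Gm : W).
Hypothesis ope : BP_OPEs (- (5 / 3)) J T Gp Gm.
Hypothesis gen : strongly_generated [:: J; T; Gp; Gm].
Local Notation gv := (gv J T Gp Gm).
Local Notation ev := (ev J T Gp Gm).
Variables (M : lmodType K) (act : vaModule W M) (u : M).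
Hypothesis u_top : forall w n, wwt w <= n -> act (ev w) n u = 0.

Definition gen_zero_mode (g : nat) (m : M) : M := act (gv g) ((gwt g)%:Z - 1) m.

Definition zval (t : zterm) : M := foldr gen_zero_mode (act (ev t.2) (wwt t.2 - 1) u) t.1.

Lemma foldr_zero_mode_linear gs : linear (fun m => foldr gen_zero_mode m gs).
Proof.
elim: gs => [|g gs IH] c m m' //=.
by rewrite IH /gen_zero_mode mode_linearr.
Qed.

Lemma act_lval n L : act (lval ev L) n u = lval (fun w => act (ev w) n u) L.
Proof.
rewrite /lval (lin_sum (mode_linearl act n u)); apply: eq_bigr => p _.
by rewrite actZl.
Qed.

(** Zhu's relations between zero modes: for j = 0 the zero mode is multiplicative up to lower
    weight, and for j > 0 it is expressed entirely by lower weights. *)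
Lemma zhu_words g (j : nat) w :
  \sum_(i < (gwt g).+1) 'C(gwt g, i)%:R *:
     act (nprod (gv g) (- j.+1%:Z + i%:Z) (ev w)) (wwt ((g, Negz j) :: w) - i%:Z - 1) u
  = if j is 0%N then gen_zero_mode g (act (ev w) (wwt w - 1) u) else 0.
Proof.
have gt i : (gwt g)%:Z <= i -> act (gv g) i u = 0.
  move=> Hi; have := @u_top [:: (g, -1)] i.
  by rewrite /= nprod_vacr => -> //; lia.
have := zhu_identity j (isT : 0 <= (gwt g)%:Z) gt (@u_top w); rewrite absz_nat => <-.
apply: eq_bigr => i _; rewrite binz_bin; congr (_ *: act _ _ _).
by rewrite wwt_cons NegzE /=; case: i => i _ /=; lia.
Qed.

Lemma lval_zstep t : lval zval (zstep t) = zval t.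
Proof.
have E1 t' : lval zval [:: (1, t')] = zval t' by rewrite lval1 scale1r.
case: t => gs [|[g [n|j]] w]; rewrite /zstep ?E1 //.
case: ifP => [/allP Hall|_]; last exact: E1.
have Hlin := foldr_zero_mode_linear gs.
have := congr1 (fun m => foldr gen_zero_mode m gs) (zhu_words g j w).
rewrite big_ord_recl (linD Hlin) bin0 scale1r addr0 subr0 => /(canRL (addrK _)).
rewrite -[- j.+1%:Z]NegzE => E; rewrite [RHS]/zval {}E lval_cat; congr (_ + _).
  case: (j) => [|j']; last by rewrite lval0 (lin0 Hlin).
  by rewrite E1 /zval foldr_rcons.
rewrite (lin_sum Hlin) -sumrN lval_flatten big_seq.
transitivity (\sum_(i <- iota 1 (gwt g)) - ('C(gwt g, i)%:R *:
   foldr gen_zero_mode (act (nprod (gv g) (Negz j + i%:Z) (ev w))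
     (wwt ((g, Negz j) :: w) - i%:Z - 1) u) gs)).
  rewrite [RHS]big_seq; apply: eq_bigr => i Hi.
  rewrite lval_scale zkN zk_int scaleNr; congr (- (_ *: _)).
  have /allP Hw := Hall i Hi.
  rewrite -(evl_lmode ope gen 10) act_lval /lval (lin_sum Hlin) big_map.
  rewrite big_seq [RHS]big_seq; apply: eq_bigr => p /Hw/eqP <-.
  by rewrite (linZ Hlin).
have -> : iota 1 (gwt g) = index_iota 1 (gwt g).+1 by rewrite /index_iota subn1.
rewrite big_add1 big_mkord.
by apply: eq_bigr => i _; rewrite (linZ Hlin).
Qed.

Lemma Omega_zero_mode : act (lval ev Omega) 3 u =
  lval zval [:: (- 36, ([:: 0; 0; 0; 0]%N, [::])); (138, ([:: 0; 0; 1]%N, [::]));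
                (- 108, ([:: 0; 2; 3]%N, [::])); (- 31, ([:: 1; 1]%N, [::]));
                (- 30, ([:: 1]%N, [::])); (- 9, ([:: 0; 0]%N, [::]));
                (- 18, ([:: 2; 3]%N, [::]))].
Proof.
have step L : lval zval (lnorm (lbind zstep L)) = lval zval L.
  rewrite lval_lnorm; apply: (lval_bind (h := id)); first by [].
  exact: lval_zstep.
transitivity (lval zval [seq (p.1, ([::], p.2)) | p <- Omega]).
  rewrite act_lval /lval big_map big_seq [RHS]big_seq; apply: eq_bigr => p pO.
  have /allP/(_ p pO)/eqP Hp : all (fun p : Z * word => wwt p.2 == 4) Omega by [].
  by rewrite /zval Hp.
(* Each pass lowers the weight of every remaining nonempty word by at least one, so four passes
   suffice from weight 4. *)
by do 4![rewrite -step]; congr lval; vm_compute.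
Qed.

End ZhuSound.

(** * The modules L(x,y) *)

Section HighestWeight.
Variables (K : numFieldType) (W : vertexAlgType K) (J T Gp Gm : W).
Hypothesis ope : BP_OPEs (- (5 / 3)) J T Gp Gm.
Hypothesis gen : strongly_generated [:: J; T; Gp; Gm].
Local Notation gv := (gv J T Gp Gm).
Local Notation ev := (ev J T Gp Gm).
Variables (M : lmodType K) (act : vaModule W M) (x y : K) (v : M).
Hypothesis hL : is_Lxy act J T Gp Gm x y v.
Hypothesis act_Omega : forall n m, act (lval ev Omega) n m = 0.
Local Notation L0 := (L0 J T act).

Lemma modeL0 m : modeL act J T 0 m = L0 m.
Proof. by rewrite /modeL /L0 add0r mul1r. Qed.

Lemma v_low g n : (gwt g)%:Z <= n -> act (gv g) n v = 0.
Proof.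
have ann := Lxy_ann hL.
have J0 m : 1 <= m -> act J m v = 0 by move=> /ann[].
case: g => [|[|[|g]]] /= Hn; rewrite ?actZl.
- by rewrite J0 ?scaler0.
- have [|_ + _ _] := ann (n - 1); first by lia.
  rewrite /modeL subrK J0; last by lia.
  by rewrite scaler0 subr0 => ->; rewrite scaler0.
- by have [] := ann n Hn.
- have [|_ _ _] := ann n; first by lia.
  by rewrite /modeGm subrK => ->; rewrite scaler0.
Qed.

Lemma eig_v : eig L0 y v.
Proof. by rewrite /eig /= -modeL0; apply: Lxy_L0 hL. Qed.

(** All of L(x,y) is spanned by modes applied to v, so its weights lie in y + i with i >= 0, while
    the vector in question has weight below y. *)
Lemma top_kill u w n : eig L0 y u -> wwt w <= n -> act (ev w) n u = 0.
Proof.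
move=> Hu Hn.
have ST : Defs.span [set m | exists b n, m = act b n v] = setT.
  apply: (Lxy_gen hL); first exact: submodule_span_modes.
  by apply: span_incl; exists vac, (-1); rewrite mode_vac.
have G := span_modes_graded ope gen v_low eig_v.
have E := eig_mode ope gen n (eig_ev ope gen w) Hu.
apply: (graded_above_eig0 _ _ E) => [i|]; last by apply: G; rewrite ST.
rewrite -[1]/(1%:~R) -!rmorphB addrC (inj_eq (addIr _)) -[i%:R]/(i%:Z%:~R) eqr_int; lia.
Qed.

Definition ladder n := iter n (act Gp 0) v.

Lemma eig_ladder n : eig L0 y (ladder n).
Proof.
elim: n => [|n IHn]; first exact: eig_v.
have := eig_mode ope gen 0 (eig_gv ope 2) IHn.
by rewrite /gwt subr0 subrr add0r.
Qed.

Lemma J0_ladder n : act J 0 (ladder n) = (x + n%:R) *: ladder n.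
Proof.
elim: n => [|n IHn]; first by rewrite addr0; apply: Lxy_J0 hL.
rewrite [ladder n.+1]/= commutator0 IHn actZr (ope_JGp ope 0) /=.
by rewrite -[X in _ + X]scale1r -scalerDl -addrA natr1.
Qed.

Lemma T1_ladder n : act T 1 (ladder n) = (y + (x + n%:R) / 2) *: ladder n.
Proof.
have := eig_ladder n; rewrite /eig /L0 /= J0_ladder scalerA => /(canRL (subrK _)) ->.
by rewrite -scalerDl [_ / 2]mulrC.
Qed.

(** The eigenvalue of [G^+(0), G^-(0)] on a top vector of charge X. *)
Definition bracket_poly (X : K) : K := 3 * X ^+ 2 + X / 3 - 4 / 3 * y.

Lemma bracket_ladder n :
  act Gp 0 (act Gm 1 (ladder n)) - act Gm 1 (ladder n.+1)
  = bracket_poly (x + n%:R) *: ladder n.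
Proof.
have kill k : 1 <= k -> act (gv 0) k (ladder n) = 0.
  by move=> Hk; have := @top_kill _ [:: (0%N, -1)] k (eig_ladder n) Hk; rewrite /= nprod_vacr.
(* Positive modes of J kill a top vector, so only the square of J_(0) survives. *)
have aa : act (nprod (gv 0) (-1) (gv 0)) 1 (ladder n) = act (gv 0) 0 (act (gv 0) 0 (ladder n)).
  rewrite (@act_normal_product _ _ _ act 3) => [|i Hi]; last first.
    split; [|apply: kill; lia|apply: kill; lia].
    rewrite /= (linZ (nprod_linearr _ _)) (linZ (nprod_linearl _ _)).
    have -> : -1 + i%:Z = i.-1%:Z by lia.
    by rewrite (ope_JJ ope) nth_default ?scaler0 //=; lia.
  rewrite big_ord_recl big1 ?addr0 => [|i _]; last first.
    by rewrite !kill ?act0r ?addr0 //= /bump; lia.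
  by rewrite kill ?act0r ?add0r.
have := comm_ef ope act 0 1 (ladder n).
rewrite add0r aa subrr /= !actZl !actZr J0_ladder actZr J0_ladder T1_ladder.
rewrite mul0r mulr1 scale0r addr0 !scalerA -scalerDl -scalerBl.
rewrite -!scalerBr => E.
apply: (@scalerI _ _ 9); first by rewrite pnatr_eq0.
by rewrite E scalerA; congr (_ *: _); rewrite /bracket_poly; field.
Qed.

Fixpoint ladder_coef n : K := if n is m.+1 then ladder_coef m - bracket_poly (x + m%:R) else 0.

Lemma Gm1_ladder n : act Gm 1 (ladder n.+1) = ladder_coef n.+1 *: ladder n.
Proof.
have Gm1_v : act Gm 1 v = 0 by have [] := Lxy_ann hL (lexx 1).
elim: n => [|n IHn].
  have := bracket_ladder 0; rewrite Gm1_v act0r sub0r => /eqP; rewrite eqr_oppLR => /eqP ->.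
  by rewrite /= sub0r scaleNr.
have := bracket_ladder n.+1; rewrite IHn actZr -[act Gp 0 (ladder n)]/(ladder n.+1) => /eqP.
rewrite subr_eq addrC -subr_eq => /eqP <-.
by rewrite -scalerBl.
Qed.

(** The terms of [Omega_zero_mode] evaluated on [ladder n]: 3 X, t and 9 h are the eigenvalues of 3
    J(0), of 6 T_(1) and of G^+(0) applied after 9 G^-(0). *)
Definition Omega_poly (X h : K) : K :=
  let t := 6 * y + 3 * X in
  - 36 * (3 * X) ^+ 4 + 138 * (3 * X) ^+ 2 * t - 108 * (3 * X) * (9 * h)
    - 31 * t ^+ 2 - 30 * t - 9 * (3 * X) ^+ 2 - 18 * (9 * h).

Lemma Omega_poly_eq0 n : ladder n != 0 -> Omega_poly (x + n%:R) (ladder_coef n) = 0.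
Proof.
rewrite /Omega_poly; set X := x + n%:R; set t := 6 * y + 3 * X => nz.
set u := ladder n in nz.
have := Omega_zero_mode ope gen (fun w k => @top_kill u w k (eig_ladder n)).
rewrite act_Omega.
have a_u c : gen_zero_mode J T Gp Gm act 0%N (c *: u) = (3 * X * c) *: u.
  by rewrite /gen_zero_mode /= subrr actZr actZl J0_ladder !scalerA; congr (_ *: _); rewrite /X; ring.
have t_u c : gen_zero_mode J T Gp Gm act 1%N (c *: u) = (t * c) *: u.
  by rewrite /gen_zero_mode /= actZr actZl T1_ladder !scalerA; congr (_ *: _); rewrite /t /X; field.
have ef_u : gen_zero_mode J T Gp Gm act 2%N (gen_zero_mode J T Gp Gm act 3%N (1 *: u))
    = (9 * ladder_coef n) *: u.
  rewrite /gen_zero_mode /= scale1r actZl actZr /u; case: (n) => [|n'].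
    have -> : act Gm (2%:Z - 1) (ladder 0) = 0 by have [] := Lxy_ann hL (lexx 1).
    by rewrite act0r scaler0 mulr0 scale0r.
  by rewrite Gm1_ladder actZr scalerA.
have vac_u : act (ev [::]) (wwt [::] - 1) u = 1 *: u.
  by rewrite /= mode_vac scale1r.
rewrite !lval_cons lval0 /zval /= vac_u !ef_u !t_u !a_u !scalerA addr0 -!scalerDl.
move/esym/eqP; rewrite scaler_eq0 (negPf nz) orbF => /eqP <-.
have zkn k : zk K k%:R = k%:R by rewrite /zk !rmorph_nat.
by rewrite !zkN !zkn; ring.
Qed.

Lemma ladder_coef_eq0 n : ladder n != 0 -> ladder n.+1 = 0 -> ladder_coef n.+1 = 0.
Proof.
move=> nz z; apply/eqP; have := Gm1_ladder n.
by rewrite z act0r => /esym/eqP; rewrite scaler_eq0 (negPf nz) orbF.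
Qed.

Lemma linear_root (a b : K) : a != 0 -> a * x + b = 0 -> x = - b / a.
Proof. by move=> na /eqP; rewrite addr_eq0 => /eqP E; rewrite -E mulrC mulKf. Qed.

(** If the ladder stops at step one or two, the vanishing of h_1 or h_2 gives y as a quadratic in x.
    Otherwise three equations hold, and their second difference fixes y. In each case one more
    equation leaves finitely many x. *)
Lemma highest_weights : (Sk `|` Sk_tilde) (x, y).
Proof.
rewrite /Sk /Sk_tilde /setU /set1 /mkset /=.
have nz0 : ladder 0 != 0 by apply/eqP/(Lxy_neq0 hL).
have n3 : 3 != 0 :> K by rewrite pnatr_eq0.
have n9 : 9 != 0 :> K by rewrite pnatr_eq0.
have R0 : Omega_poly x 0 = 0 by have := Omega_poly_eq0 nz0; rewrite addr0.
have [z1|nz1] := eqVneq (ladder 1) 0.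
  have := ladder_coef_eq0 nz0 z1; rewrite /= addr0 /bracket_poly => E.
  have Ey : y = (9 * x ^+ 2 + x) / 4.
    have -> : y = 3 / 4 * (0 - (3 * x ^+ 2 + x / 3 - 4 / 3 * y)) + (9 * x ^+ 2 + x) / 4 by field.
    by rewrite E mulr0 add0r.
  have : 135 / 4 * (x * (9 * x + 1) * (3 * x - 1) * (9 * x + 4)) = 0.
    by rewrite -[RHS]R0 /Omega_poly Ey; field.
  move/eqP; rewrite !mulf_eq0 invr_eq0 !pnatr_eq0 /= -!orbA => /or4P[]/eqP Ex.
  - by left; do 4!left; right; rewrite Ey Ex /=; congr (_, _); ring.
  - by left; do 5!left; rewrite Ey (linear_root n9 Ex) /=; congr (_, _); field.
  - by left; do 3!left; right; rewrite Ey (linear_root n3 Ex) /=; congr (_, _); field.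
  - by left; left; right; rewrite Ey (linear_root n9 Ex) /=; congr (_, _); field.
have R1 : Omega_poly (x + 1) (0 - bracket_poly x) = 0 by have := Omega_poly_eq0 nz1; rewrite /= addr0.
have [z2|nz2] := eqVneq (ladder 2) 0.
  have := ladder_coef_eq0 nz1 z2; rewrite /= addr0 /bracket_poly => E.
  have Ey : y = 3 / 8 * (3 * x ^+ 2 + 3 * (x + 1) ^+ 2 + (2 * x + 1) / 3).
    have -> : y = 3 / 8 * (0 - (3 * x ^+ 2 + x / 3 - 4 / 3 * y)
        - (3 * (x + 1) ^+ 2 + (x + 1) / 3 - 4 / 3 * y))
      + 3 / 8 * (3 * x ^+ 2 + 3 * (x + 1) ^+ 2 + (2 * x + 1) / 3) by field.
    by rewrite E mulr0 add0r.
  have : 90 * ((3 * x + 1) * (9 * x + 7) * (9 * x + 5)) = 0.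
    by transitivity (Omega_poly (x + 1) (0 - bracket_poly x) - Omega_poly x 0);
      [rewrite /Omega_poly /bracket_poly Ey; field | rewrite R1 R0 subrr].
  move/eqP; rewrite !mulf_eq0 !pnatr_eq0 /= -!orbA => /or3P[]/eqP Ex.
  - by left; do 2!left; right; rewrite Ey (linear_root n3 Ex) /=; congr (_, _); field.
  - by left; right; rewrite Ey (linear_root n9 Ex) /=; congr (_, _); field.
  (* The root x = -5/9 of the difference of the two equations is spurious: the equation on v itself
     fails there. *)
  - have : 200 = 0 :> K by rewrite -R0 /Omega_poly Ey (linear_root n9 Ex); field.
    by move/eqP; rewrite pnatr_eq0.
have R2 : Omega_poly (x + 2) (0 - bracket_poly x - bracket_poly (x + 1)) = 0.
  by have := Omega_poly_eq0 nz2; rewrite /= addr0.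
have Ey : y = - (1 / 9).
  have : 7128 * (y + 1 / 9) = 0.
    transitivity (Omega_poly (x + 2) (0 - bracket_poly x - bracket_poly (x + 1))
      - 2 * Omega_poly (x + 1) (0 - bracket_poly x) + Omega_poly x 0).
      by rewrite /Omega_poly /bracket_poly; field.
    by rewrite R2 R1 R0 mulr0 subr0 addr0.
  by move/eqP; rewrite mulf_eq0 pnatr_eq0 /= addr_eq0 => /eqP.
(* With y fixed, the first difference is a cubic whose roots are the three charges of [Sk_tilde]. *)
have : 4 * ((9 * x - 1) * (9 * x - 4) * (9 * x - 7)) = 0.
  transitivity (Omega_poly x 0 - Omega_poly (x + 1) (0 - bracket_poly x)); last by rewrite R1 R0 subrr.
  by rewrite /Omega_poly /bracket_poly Ey; field.
move/eqP; rewrite !mulf_eq0 !pnatr_eq0 /= -!orbA => /or3P[]/eqP Ex;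
  right; rewrite Ey (linear_root n9 Ex) opprK.
- by left; left.
- by left; right.
- by right.
Qed.

(** Here x > 0 and y < 0, so every bracket eigenvalue is positive, h_n never vanishes for n > 0, and
    the ladder never stops. Its vectors have distinct J(0)-charges, hence are independent. *)
Lemma top_infinite : Sk_tilde (x, y) -> ~ finite_dim (Lxy_top act J T y).
Proof.
move=> Hxy.
have [x0 Ey] : 0 < x /\ y = - (1 / 9).
  by case: Hxy => [[|]|] [-> ->]; rewrite divr_gt0 ?ltr0n.
have hneg n : 0 < - ladder_coef n.+1.
  have g0 m : 0 < bracket_poly (x + m%:R).
    have X0 : 0 < x + m%:R by rewrite ltr_wpDr // ler0n.
    by rewrite /bracket_poly Ey mulrN opprK ?addr_gt0 ?mulr_gt0 ?invr_gt0 ?exprn_gt0 ?ltr0n.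
  elim: n => [|n IHn]; first by rewrite /= opprB subr0.
  rewrite -[ladder_coef n.+2]/(ladder_coef n.+1 - bracket_poly (x + n.+1%:R)) opprB.
  exact: addr_gt0.
have nz n : ladder n != 0.
  elim: n => [|n IHn]; first by apply/eqP/(Lxy_neq0 hL).
  apply/eqP => /(ladder_coef_eq0 IHn) E; have := hneg n.
  by rewrite E oppr0 ltxx.
move=> [N [e topE]].
have coords m : Defs.span (range e) m -> exists c : 'rV_N, m = \sum_j c 0 j *: e j.
  apply: (@span_sub _ _ [set m | exists c : 'rV_N, m = \sum_j c 0 j *: e j]).
    split=> [|k u w [c ->] [d ->]]; first by exists 0; rewrite big1 // => j _; rewrite mxE scale0r.
    exists (k *: c + d); rewrite scaler_sumr -big_split; apply: eq_bigr => j _ /=.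
    by rewrite !mxE scalerDl scalerA.
  move=> _ [j _ <-]; exists (delta_mx 0 j).
  rewrite (bigD1 j) //= mxE !eqxx scale1r big1 ?addr0 // => i ij.
  by rewrite mxE (negPf ij) andbF scale0r.
have /choice[c Hc] : forall i : 'I_N.+1, exists c : 'rV_N, ladder i = \sum_j c 0 j *: e j.
  move=> i; apply: coords; rewrite -topE /Lxy_top /= modeL0.
  exact: eig_ladder.
(* Coordinates of N + 1 ladder vectors on N spanning vectors: the matrix has more rows than columns,
   so a nonzero row [r] annihilates it. *)
pose A := \matrix_(i < N.+1, j < N) c i 0 j.
have /rowV0Pn[r /sub_kermxP rA nzr] : kermx A != 0.
  by rewrite kermx_eq0 /row_free neq_ltn ltnS rank_leq_col.
have sum0 : \sum_i r 0 i *: ladder i = 0.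
  under eq_bigr do rewrite Hc scaler_sumr.
  rewrite exchange_big /= big1 // => j _.
  under eq_bigr do rewrite scalerA.
  rewrite -scaler_suml.
  have := congr1 (fun B : 'rV_N => B 0 j) rA; rewrite !mxE => E.
  rewrite (eq_bigr (fun i => r 0 i * A i j)) => [|i _]; last by rewrite mxE.
  by rewrite E scale0r.
have [k nzk] : exists k, r 0 k != 0 by apply/rV0Pn.
have linJ : linear (act J 0) := mode_linearr act J 0.
have eJ n (a : K) : eig (act J 0) (x + n%:R) (a *: ladder n).
  by apply: (subspaceZ (eig_subspace linJ _)); apply: J0_ladder.
have : r 0 k *: ladder k = 0.
  (* The relation writes the k-th term through the others. Slot k holds the zero vector with the
     dummy charge x + N + 1, which differs from x + k. *)
  apply: (@eig_sum_eq0 _ _ _ linJ N.+1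
    (fun i => x + (if i == k then N.+1 else i)%:R)
    (fun i => if i == k then 0 else - r 0 i *: ladder i) (x + k%:R)) => [i||].
  - rewrite (inj_eq (addrI x)) eqr_nat; case: eqP => [_|/eqP ik].
      by split; [exact: (subspace0 (eig_subspace linJ _)) | rewrite neq_ltn ltn_ord orbT].
    by split; [exact: eJ | exact: ik].
  - exact: eJ.
  - rewrite (bigD1 k) //= eqxx add0r.
    under eq_bigr => i /negPf-> do rewrite scaleNr.
    by rewrite sumrN; move: sum0; rewrite (bigD1 k) //= => /eqP; rewrite addr_eq0 => /eqP.
by move/eqP; rewrite scaler_eq0 (negPf nzk) (negPf (nz k)).
Qed.

End HighestWeight.

Unset Implicit Arguments.

Theorem proposition5p5 (R : realType)
    (* W^k with its generating fields, and its simple quotient W_k *)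
    (W : vertexAlgType R[i]) (J T Gp Gm : W)
    (hW : universal_BP (- (5 / 3)) J T Gp Gm)
    (Wk : vertexAlgType R[i]) (pi : W -> Wk)
    (hpi : is_simple_quotient pi)
    (* L(x,y), assumed to be a W_k-module *)
    (x y : R[i]) (M : lmodType R[i]) (act : vaModule W M) (v : M)
    (hL : is_Lxy act J T Gp Gm x y v)
    (hk : factors_through pi act) :
  (Sk `|` Sk_tilde) (x, y) /\
  (finite_dim (Lxy_top act J T y) -> Sk (x, y)).
Proof.
have [ope gen _] := hW; have [pi_hom pi_surj simp] := hpi.
have Omega0 n m : act (lval (ev J T Gp Gm) Omega) n m = 0.
  by have [act' ->] := hk; rewrite (pi_Omega ope gen pi_hom pi_surj simp) act0l.
have Hxy := highest_weights ope gen hL Omega0.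
split=> // fin; case: Hxy => // /(top_infinite ope gen hL).
by case.
Qed.
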